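(* Let $k \geq 2$ be an integer and let $H = ((V,\mathcal{A},\mu),E)$ be a $k$-uniform measurable hypergraph such that $(V,\mathcal{A},\mu)$ is a finite, countably generated measure space. If $\alpha(H) > 0$ and $E$ is thick, then $$\alpha(H) = \vartheta_{\mathrm{big}}(H, \mathrm{CP}(V,k)).$$
   Context: All functions and measures are real valued. A measure space is countably generated if its $\sigma$-algebra is. $V^k$ carries the product measure $\mu^k$. A $k$-uniform measurable hypergraph $H=((V,\mathcal{A},\mu),E)$ is a $k$-uniform hypergraph with vertex set $V$ whose edges are $k$-element subsets of $V$; $E$ is identified with the symmetric set of tuples $(v_1,\dots,v_k)\in V^k$ with $\{v_1,\dots,v_k\}$ an edge, and this set is required to be measurable in $V^k$. A set $I\subseteq V$ is independent if it contains no edge, i.e. $I^k\cap E=\emptyset$. $\alpha(H)=\sup\{\mu(I): I\subseteq V \text{ measurable and independent}\}$. $L^2_{\mathrm{sym}}(V,k)$ is the space of (classes of) square-integrable functions on $V^k$ invariant under permutation of the $k$ coordinates, with $\langle F,G\rangle=\int FG\,d\mu^k$. $f^{\otimes k}(v_1,\dots,v_k)=f(v_1)\cdots f(v_k)$; $\mathbf 1$ is the constant function $1$. $\mathrm{CP}(V,k)\subseteq L^2_{\mathrm{sym}}(V,k)$ is the closed convex cone generated by all $f^{\otimes k}$ with $f\in L^2(V)$, $f\ge 0$. For $A\in L^2_{\mathrm{sym}}(V,k)$ put $(\mathcal T_{k-2}^*A)(x,y)=\int_{V^{k-2}}A(x,y,v)\,d\mu^{k-2}(v)$ (so $\mathcal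 T_0^*A=A$). $A$ is slice positive if $\int_{V^{k-2}}\int_V\int_V A(x,y,v)G(v)f(x)f(y)\ge 0$ for all $0\le G\in L^2(V^{k-2})$ and $f\in L^2(V)$. For a convex cone $\mathcal C\subseteq L^2_{\mathrm{sym}}(V,k)$, $\vartheta_{\mathrm{big}}(H,\mathcal C)$ is the supremum of $\langle A,\mathbf 1^{\otimes k}\rangle$ over all slice-positive $A\in\mathcal C$ such that $\mathrm{Tr}(\mathcal T_{k-2}^*A)=1$ (meaning the kernel $\mathcal T_{k-2}^*A$ is trace class with trace $1$) and $A(v_1,\dots,v_k)=0$ for all $v_1\cdots v_k\in E$ (for an $L^2$ class: $A$ has a representative vanishing on $E$). Thick sets: let $\mathcal A^+$ be the family of measurable sets of nonzero measure. Let $\mathcal D\subseteq\mathcal A^+$ be such that for each $v$ the sets $D\in\mathcal D$ containing $v$ are directed by reverse inclusion. For $A\in\mathcal A^+$ and $v\in V$, $\mathrm{dens}_v(A)=\lim_{v\in D\in\mathcal D}\mu(D\cap A)/\mu(D)$ when the limit exists, and $D(A)=\{v:\mathrm{dens}_v(A)=1\}$. $\mathcal D$ is a density system if $\mu(A\,\triangle\, D(A))=0$ for all $A\in\mathcal A^+$. $E\subseteq V^k$ is $\mathcal D$-thick if for all $(v_1,\dots,v_k)\in E$, $$\lim_{D_1,\dots,D_k\in\mathcal D,\ v_i\in D_i}\frac{\mu^k((D_1\times\cdots\times D_k)\cap E)}{\mu(D_1)\cdots\mu(D_k)}>0 .$$ $E$ is thick if it is $\mathcal D$-thick for some density system $\mathcal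 D$. *)

(* Defs.v *)
From HB Require Import structures.
From mathcomp Require Import all_boot all_order all_algebra perm.
From mathcomp Require Import all_classical all_reals all_analysis.

Set Implicit Arguments.
Unset Strict Implicit.
Unset Printing Implicit Defensive.

Import Order.TTheory GRing.Theory Num.Theory.
Import numFieldNormedType.Exports.

Local Open Scope classical_set_scope.
Local Open Scope ring_scope.

Section power_measure.
Context d (V : measurableType d) (R : realType).
Variable mu : {finite_measure set V -> \bar R}.

Definition tcons n (x : V * n.-tuple V) : n.+1.-tuple V :=
  [the n.+1.-tuple V of x.1 :: x.2].

Lemma measurable_tcons n : measurable_fun [set: V * n.-tuple V] (@tcons n).
Proof. exact: measurable_cons. Qed.

Section step.
Variables (n : nat) (nu : {finite_measure set (n.-tuple V) -> \bar R}).

Definition mpowS : set (n.+1.-tuple V) -> \bar R :=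
  pushforward (mu \x nu)%E (@tcons n).

Let mpowS0 : mpowS set0 = 0%E.
Proof. by rewrite /mpowS /pushforward preimage_set0 measure0. Qed.

Let mpowS_ge0 A : (0 <= mpowS A)%E.
Proof. by rewrite /mpowS /pushforward; exact: measure_ge0. Qed.

Let mpowS_sigma_additive : semi_sigma_additive mpowS.
Proof.
exact: (@measure_semi_sigma_additive _ _ _
  (measure_function_pushforward__canonical__measure_function_Measure
    (mu \x nu)%E (@measurable_tcons n))).
Qed.

HB.instance Definition _ :=
  isMeasure.Build _ _ _ mpowS mpowS0 mpowS_ge0 mpowS_sigma_additive.

Let mpowS_fin : fin_num_fun mpowS.
Proof.
move=> A mA; rewrite ge0_fin_numE//.
apply: (@le_lt_trans _ _ ((mu \x nu)%E setT)).
  rewrite /mpowS /pushforward; apply: le_measure; rewrite ?inE//.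
  by rewrite -[X in measurable X]setTI; exact: measurable_tcons.
rewrite -setXTT product_measure1E//.
by rewrite lte_mul_pinfty// ?ge0_fin_numE// ?ltry// -ge0_fin_numE// fin_num_measure.
Qed.

HB.instance Definition _ := @Measure_isFinite.Build _ _ _ mpowS mpowS_fin.

End step.

(* The product measure mu^n on V^n, by iterated binary products; see mpow_box. *)
Fixpoint mpow n : {finite_measure set (n.-tuple V) -> \bar R} :=
  if n is m.+1 then mpowS (mpow m) else dirac [tuple].

Lemma mpow_box n (B : 'I_n -> set V) : (forall i, measurable (B i)) ->
  mpow n [set t | forall i, B i (tnth t i)] = (\prod_(i < n) mu (B i))%E.
Proof.
elim: n B => [|n IH] B mB.
  rewrite big_ord0 /= diracE mem_set//= => -[].
  by [].
have mT : measurable [set t : n.-tuple V | forall i, B (lift ord0 i) (tnth t i)].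
  rewrite (_ : mkset _ =
      \bigcap_i ((@tnth n V)^~ i @^-1` B (lift ord0 i))).
    apply: fin_bigcap_measurable => // i _.
    by rewrite -[X in measurable X]setTI; exact: measurable_tnth.
  by apply/seteqP; split => t h i //=; exact: h.
rewrite big_ord_recl -IH// -product_measure1E//.
rewrite /= /mpowS /pushforward; congr (_ _).
apply/seteqP; split => -[x t] /= h.
  split; first exact: h ord0.
  by move=> i; have := h (lift ord0 i); rewrite tnthS.
move=> i; case: (unliftP ord0 i) => [j|] ->; first by rewrite tnthS; exact: h.2.
by rewrite tnth0; exact: h.1.
Qed.

End power_measure.

Definition countably_generated d (V : measurableType d) : Prop :=
  exists G : (set V)^nat, @measurable d V = <<s range G >>.

Section hypergraph.
Context d (V : measurableType d).

Definition edge_tuples k (edges : set (set V)) : set (k.-tuple V) :=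
  [set t | edges [set x | x \in (t : seq V)]].

Record measurable_hypergraph (k : nat) := MeasurableHypergraph {
  edges : set (set V);
  edges_card : forall e, edges e -> (e #= `I_k)%card;
  edges_measurable : measurable (@edge_tuples k edges) }.

Definition tuples_of k (H : measurable_hypergraph k) : set (k.-tuple V) :=
  @edge_tuples k (edges H).

Definition independent k (H : measurable_hypergraph k) (I : set V) : Prop :=
  forall e, edges H e -> ~ (e `<=` I).

Definition alpha (R : realType) (mu : set V -> \bar R) k
    (H : measurable_hypergraph k) : \bar R :=
  ereal_sup [set mu I | I in [set I | measurable I /\ independent H I]].

End hypergraph.

(* Elements of L^2 are represented by square-integrable functions; all the
   notions below depend only on their classes modulo a.e. equality. *)
Section L2.
Context d (T : measurableType d) (R : realType).
Variable m : {measure set T -> \bar R}.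

Definition L2 (f : T -> R) : Prop := f \in Lfun m 2%:E.

Definition norm2 (f : T -> R) : \bar R := ('N[m]_2%:E[EFin \o f])%E.

Definition inner (f g : T -> R) : R := \int[m]_x (f x * g x).

End L2.

Section trace.
Context d (V : measurableType d) (R : realType).
Variable mu : {finite_measure set V -> \bar R}.

(* A singular value decomposition K(x, y) = sum_n s_n u_n(x) v_n(y) in L^2:
   the s_n are the singular values of the integral operator with kernel K, and
   (u_n), (v_n) are orthonormal over the indices with s_n <> 0 (so that finite
   rank, and finite-dimensional L^2(V), are covered). *)
Definition singular_decomposition (K : V * V -> R) (s : nat -> R)
    (u v : nat -> V -> R) : Prop :=
  [/\ forall n, 0 <= s n,
      forall n, L2 mu (u n) /\ L2 mu (v n),
      forall m n, s m != 0 -> s n != 0 ->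
        inner mu (u m) (u n) = (m == n)%:R /\
        inner mu (v m) (v n) = (m == n)%:R &
      norm2 (mu \x mu)%E (fun p => K p -
        \sum_(i < n) s i * u i p.1 * v i p.2) @[n --> \oo] --> 0%E].

(* Trace class: the singular values are summable. The trace
   sum_n <K e_n, e_n>, evaluated in an orthonormal basis extending
   (v_n)_{s_n <> 0}, is sum_n <K v_n, v_n> = sum_n s_n <u_n, v_n>, the other
   basis vectors being in the kernel of the operator. *)
Definition trace_class_with_trace (K : V * V -> R) (t : R) : Prop :=
  L2 (mu \x mu)%E K /\
  exists s u v, [/\ singular_decomposition K s u v,
    cvgn (series s) &
    series (fun n => s n * inner mu (u n) (v n)) @ \oo --> t].

End trace.

Section theta.
Context d (V : measurableType d) (R : realType).
Variable mu : {finite_measure set V -> \bar R}.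
Variable k : nat.

Local Notation muk := (mpow mu k).

Definition L2sym (A : k.-tuple V -> R) : Prop :=
  L2 muk A /\
  forall s : 'S_k,
    {ae muk, forall t, A [tuple tnth t (s i) | i < k] = A t}.

Definition tensor_pow (f : V -> R) (t : k.-tuple V) : R :=
  \prod_(i < k) f (tnth t i).

(* Closed convex cone generated by the f^{(x) k} with f >= 0 in L^2(V): the
   L^2-closure of the set of their finite conic combinations. *)
Definition CP : set (k.-tuple V -> R) := [set A | L2sym A /\
  forall e : R, 0 < e ->
  exists (n : nat) (c : 'I_n -> R) (f : 'I_n -> V -> R),
    (forall i, [/\ 0 <= c i, L2 mu (f i) & forall x, 0 <= f i x]) /\
    (norm2 muk (fun t => A t - \sum_(i < n) c i * tensor_pow (f i) t)%R
       < e%:E)%E].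

(* The tuple (x, y, v), of length k when k >= 2 (junk when k < 2). *)
Definition cons2 (x y : V) (v : k.-2.-tuple V) : k.-tuple V :=
  [tuple nth x [:: x, y & v] i | i < k].

Definition slice_positive (A : k.-tuple V -> R) : Prop :=
  forall (G : k.-2.-tuple V -> R) (f : V -> R),
    L2 (mpow mu k.-2) G -> (forall v, 0 <= G v) -> L2 mu f ->
    0 <= \int[mpow mu k.-2]_v \int[mu]_x \int[mu]_y
           (A (cons2 x y v) * G v * f x * f y).

Definition Tstar (A : k.-tuple V -> R) (p : V * V) : R :=
  \int[mpow mu k.-2]_v A (cons2 p.1 p.2 v).

Definition vanishes_on (E : set (k.-tuple V)) (A : k.-tuple V -> R) : Prop :=
  exists B, [/\ L2 muk B, {ae muk, forall t, B t = A t} &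
    forall t, E t -> B t = 0].

Definition theta_big (H : measurable_hypergraph V k)
    (C : set (k.-tuple V -> R)) : \bar R :=
  ereal_sup [set (inner muk A (tensor_pow (cst 1)))%:E | A in
    [set A | [/\ C A, slice_positive A, trace_class_with_trace mu (Tstar A) 1
               & vanishes_on (tuples_of H) A]]].

End theta.

Arguments CP {d V R} mu k.

Section thick.
Context d (V : measurableType d) (R : realType).
Variable mu : {finite_measure set V -> \bar R}.
Implicit Types (D : set (set V)).

(* The tail filters of the nets {B in D | v in B} and, coordinatewise, of their
   k-fold products, ordered by reverse inclusion. If no B in D contains v, they
   are empty and no limit along them exists. *)
Definition shrink D (v : V) : set_system (set V) :=
  filter_from [set B | D B /\ B v]
    (fun B => [set B' | [/\ D B', B' v & B' `<=` B]]).

Definition shrink_tuple D k (t : k.-tuple V) : set_system ('I_k -> set V) :=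
  filter_from [set B | forall i, D (B i) /\ B i (tnth t i)]
    (fun B => [set B' | forall i,
       [/\ D (B' i), B' i (tnth t i) & B' i `<=` B i]]).

Definition has_density D (A : set V) (v : V) (l : R) : Prop :=
  (fun B => fine (mu (B `&` A)) / fine (mu B)) @ shrink D v --> l.

Definition density_points D (A : set V) : set V :=
  [set v | has_density D A v 1].

(* density_points D A need not be measurable; "mu of the symmetric difference is
   0" is read as: the difference is contained in a measurable null set. *)
Definition density_system D : Prop :=
  [/\ forall B, D B -> measurable B /\ (0 < mu B)%E,
      forall v B1 B2, D B1 -> B1 v -> D B2 -> B2 v ->
        exists B3, [/\ D B3, B3 v, B3 `<=` B1 & B3 `<=` B2] &
      forall A, measurable A -> (0 < mu A)%E ->
        mu.-negligible (A `+` density_points D A)].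

Definition thick_wrt D k (E : set (k.-tuple V)) : Prop :=
  forall t, E t -> exists l : R, 0 < l /\
    (fun B : 'I_k -> set V =>
       fine (mpow mu k ([set s | forall i, B i (tnth s i)] `&` E)) /
       \prod_(i < k) fine (mu (B i))) @ shrink_tuple D t --> l.

Definition thick k (E : set (k.-tuple V)) : Prop :=
  exists D, density_system D /\ thick_wrt D E.

End thick.

(* Main.v *)
From HB Require Import structures.
Require Import Defs.
From mathcomp Require Import all_boot all_order all_algebra.
From mathcomp Require Import all_classical all_reals all_analysis.
From mathcomp Require Import measurable_realfun ring lra.

Set Implicit Arguments.
Unset Strict Implicit.
Unset Printing Implicit Defensive.

Import Order.TTheory GRing.Theory Num.Theory.
Import numFieldNormedType.Exports.

Local Open Scope classical_set_scope.
Local Open Scope ring_scope.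

(** Write k = n + 2, let lam be the integral of a feasible kernel A, and let E
    be the set of edge tuples.

    An independent set I of positive measure gives a feasible kernel, a multiple
    of the k-th tensor power of its indicator; the normalisation that makes the
    trace 1 makes the integral equal to mu(I). This is [independent_le_theta].

    For the other inequality, suppose first that V is finite. Then A is a
    conic combination of powers f^k, each f scaled so that its integral is 1,
    with weights c_f. The integral of A is the sum of the c_f, the trace is the
    sum of the c_f |f|^2, and no f^k charges E. As the trace is 1, some f has
    |f|^2 <= 1 / lam; its support is independent and, by Cauchy-Schwarz, has
    measure at least 1 / |f|^2 >= lam.

    In general A is only an L2 limit of such combinations, along which neither
    the trace nor the vanishing on E is controlled. The trace becomes
    controllable after averaging over a finite partition: the averaged trace is
    a finite combination of integrals of A over boxes, and for A itself it is at
    most 1 because a positive kernel has equal left and right singular vectors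
    ([trace_cells]). Taking the partition fine enough for E to be close to a
    union of boxes, the argument of the finite case gives a function f with
    integral 1, |f|^2 <= 1 / lam + e and f^k(E) <= e ([near_optimal]).

    A sequence of such functions with e -> 0 converges weakly to a measure nu
    which is dominated by mu, satisfies nu(B)^2 <= mu(B) / lam, has total mass 1
    and has nu^k(E) = 0 ([weak_limit]). If S is the set where the density of nu
    is positive, then mu(S) >= lam and E meets S^k in a null set
    ([mpow_null_support]). Thickness turns this into independence: a tuple of E
    all of whose entries are density points of S would be surrounded by small
    boxes that are nearly filled by S^k and of which E occupies a fixed
    proportion ([density_points_edge_free]). Removing a null set from S leaves an
    independent set, whence lam <= alpha. *)

(** * Square-integrable functions *)

Section square_integrable.
Context d (T : measurableType d) (R : realType).
Variable m : {measure set T -> \bar R}.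
Implicit Types f g h : T -> R.

Lemma L2_measurable f : L2 m f -> measurable_fun setT f.
Proof. by rewrite /L2 inE => /andP[]; rewrite !inE. Qed.

Lemma L2_integrableM f g : L2 m f -> L2 m g ->
  m.-integrable setT (EFin \o (fun x => f x * g x)).
Proof. by move=> ? ?; apply/Lfun1_integrable/Lfun2_mul_Lfun1. Qed.

(** Trades the real powers in the definition of the norm for the product f f,
    to which the lemmas on integrals of products apply. *)
Lemma L2P f : L2 m f <->
  measurable_fun setT f /\ m.-integrable setT (EFin \o (fun x => f x * f x)).
Proof.
split=> [L2f|[mf iff]].
  by split; [exact: L2_measurable | exact: L2_integrableM].
rewrite /L2 inE; apply/andP; split; rewrite inE//= /finite_norm unlock /=.
rewrite poweR_lty//; move/integrableP: iff => [_]; apply: le_lt_trans.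
apply: ge0_le_integral => //=.
- apply/measurable_EFinP.
  apply: (@measurableT_comp _ _ _ _ _ _ (fun x : R => x `^ 2)%R) => //.
  exact/measurableT_comp.
- apply/measurable_EFinP; apply: measurableT_comp => //.
  exact: measurable_funM.
- by move=> x _; rewrite lee_fin powR_mulrn// normrM expr2.
Qed.

Lemma L2D f g : L2 m f -> L2 m g -> L2 m (fun x => f x + g x).
Proof. by move=> ? ?; apply: rpredD => //; rewrite lee1n. Qed.

Lemma L2Z a f : L2 m f -> L2 m (fun x => a * f x).
Proof.
move=> L2f; have := @Lfun_scale _ _ _ m f a 2 (ler1n _ 2%N) L2f.
by rewrite (_ : a \o* f = fun x => a * f x)//; apply/funext => x /=; rewrite mulrC.
Qed.

Lemma L2B f g : L2 m f -> L2 m g -> L2 m (fun x => f x - g x).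
Proof.
move=> L2f L2g; have := L2D L2f (L2Z (-1) L2g).
by congr L2; apply/funext => x; rewrite mulN1r.
Qed.

Lemma L2_0 : L2 m (fun=> 0).
Proof.
by apply/L2P; split => //; rewrite /comp mulr0; exact: integrable0.
Qed.

Lemma L2_sum I (r : seq I) (f : I -> T -> R) : (forall i, L2 m (f i)) ->
  L2 m (fun x => \sum_(i <- r) f i x).
Proof.
move=> L2f; elim: r => [|i r IH].
  by under eq_fun do rewrite big_nil; exact: L2_0.
by under eq_fun do rewrite big_cons; exact: L2D.
Qed.

Lemma innerC f g : inner m f g = inner m g f.
Proof. by rewrite /inner; under eq_Rintegral do rewrite mulrC. Qed.

Lemma innerDl f g h : L2 m f -> L2 m g -> L2 m h ->
  inner m (fun x => f x + g x) h = inner m f h + inner m g h.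
Proof.
move=> L2f L2g L2h; rewrite /inner -RintegralD//; last 2 first.
- exact: L2_integrableM.
- exact: L2_integrableM.
by apply: eq_Rintegral => x _; rewrite mulrDl.
Qed.

Lemma innerZl a f h : L2 m f -> L2 m h ->
  inner m (fun x => a * f x) h = a * inner m f h.
Proof.
move=> L2f L2h; rewrite /inner -RintegralZl//; last exact: L2_integrableM.
by apply: eq_Rintegral => x _; rewrite mulrA.
Qed.

Lemma innerBl f g h : L2 m f -> L2 m g -> L2 m h ->
  inner m (fun x => f x - g x) h = inner m f h - inner m g h.
Proof.
move=> L2f L2g L2h; rewrite /inner -RintegralB//; last 2 first.
- exact: L2_integrableM.
- exact: L2_integrableM.
by apply: eq_Rintegral => x _; rewrite mulrBl.
Qed.

Lemma inner_suml I (r : seq I) (c : I -> R) (f : I -> T -> R) h :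
  (forall i, L2 m (f i)) -> L2 m h ->
  inner m (fun x => \sum_(i <- r) c i * f i x) h =
  \sum_(i <- r) c i * inner m (f i) h.
Proof.
move=> L2f L2h; elim: r => [|i r IH].
  rewrite big_nil /inner; under eq_Rintegral do rewrite big_nil mul0r.
  by rewrite Rintegral_cst// mul0r.
rewrite big_cons -IH -innerZl// -innerDl//; last 2 first.
- exact: L2Z.
- by apply: L2_sum => l; exact: L2Z.
by congr inner; apply/funext => x; rewrite big_cons.
Qed.

Lemma inner_ge0 f : 0 <= inner m f f.
Proof. by apply: Rintegral_ge0 => x _; rewrite -expr2 sqr_ge0. Qed.

(** Nonnegativity of |f + t g|^2 at the minimising t, cleared of denominators;
    when |g| = 0 a large t forces the cross term to vanish. *)
Lemma cauchy_schwarz f g : L2 m f -> L2 m g ->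
  inner m f g ^+ 2 <= inner m f f * inner m g g.
Proof.
move=> L2f L2g.
set a := inner m f f; set b := inner m f g; set c := inner m g g.
have key s t : 0 <= s ^+ 2 * a + 2 * s * t * b + t ^+ 2 * c.
  have L2s := L2Z s L2f; have L2t := L2Z t L2g; have L2st := L2D L2s L2t.
  have := inner_ge0 (fun x => s * f x + t * g x).
  rewrite innerDl// !innerZl// ![inner m _ (fun x => _ + _)]innerC !innerDl//.
  rewrite !innerZl// [inner m g f]innerC -/a -/b -/c; nra.
have c0 : 0 <= c by exact: inner_ge0.
have [c_gt0|c_le0] := ltP 0 c.
  have := key c (- b); have -> : c ^+ 2 * a + 2 * c * - b * b + (- b) ^+ 2 * c =
    c * (a * c - b ^+ 2) by ring.
  by rewrite pmulr_rge0// subr_ge0.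
have cE : c = 0 by apply/eqP; rewrite eq_le c_le0 c0.
have [->|b0] := eqVneq b 0; first by rewrite expr0n/= mulr_ge0// inner_ge0.
have := key 1 (- (a + 1) / (2 * b)); rewrite cE.
have -> : 1 ^+ 2 * a + 2 * 1 * (- (a + 1) / (2 * b)) * b +
  (- (a + 1) / (2 * b)) ^+ 2 * 0 = -1 by field.
by rewrite ler0N1.
Qed.

Lemma norm_inner_le f g : L2 m f -> L2 m g ->
  `|inner m f g| <= Num.sqrt (inner m f f) * Num.sqrt (inner m g g).
Proof.
move=> L2f L2g; rewrite -sqrtrM ?inner_ge0// -sqrtr_sqr ler_sqrt ?cauchy_schwarz//.
by rewrite mulr_ge0 ?inner_ge0.
Qed.

Lemma norm2E f : L2 m f -> norm2 m f = (Num.sqrt (inner m f f))%:E.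
Proof.
move=> L2f; rewrite /norm2 unlock /=.
have -> : (\int[m]_x (`|f x| `^ 2)%:E)%E = (inner m f f)%:E.
  rewrite /inner /Rintegral fineK; last first.
    by apply: integrable_fin_num => //; exact: L2_integrableM.
  apply: eq_integral => x _.
  by rewrite /= powR_mulrn// real_normK ?num_real// expr2.
by rewrite poweR_EFin powR12_sqrt// inner_ge0.
Qed.

Lemma norm2_0 : norm2 m (fun=> 0) = 0%E.
Proof.
rewrite norm2E; last exact: L2_0.
rewrite /inner; under eq_Rintegral do rewrite mulr0.
by rewrite Rintegral_cst// mul0r sqrtr0.
Qed.

Lemma inner_lt_norm2 f e : 0 < e -> L2 m f -> (norm2 m f < e%:E)%E ->
  Num.sqrt (inner m f f) < e.
Proof. by move=> e0 L2f; rewrite norm2E// lte_fin. Qed.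

End square_integrable.

Section finite_square_integrable.
Context d (T : measurableType d) (R : realType).
Variable m : {finite_measure set T -> \bar R}.

Lemma L2_indic (A : set T) : measurable A -> L2 m (\1_A : T -> R).
Proof.
move=> mA; apply/L2P; split => //.
rewrite (_ : _ \o _ = EFin \o (\1_A : T -> R)); last first.
  by apply/funext => x /=; rewrite indicE; case: (_ \in _); rewrite ?mulr1 ?mulr0.
exact: integrable_indic.
Qed.

Lemma L2_cst (c : R) : L2 m (cst c).
Proof. exact: Lfun_cst. Qed.

Lemma inner_indic (A B : set T) : measurable A -> measurable B ->
  inner m (\1_A) (\1_B) = fine (m (A `&` B)).
Proof.
move=> mA mB; rewrite /inner /Rintegral.
under eq_integral do rewrite -[_ * _]/((\1_A \* \1_B) _) -indicI.
by rewrite integral_indic ?setIT//; exact: measurableI.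
Qed.

Lemma L2_integrable f : L2 m f -> m.-integrable setT (EFin \o f).
Proof.
by move=> L2f; apply/Lfun1_integrable/Lfun_subset12 => //; exact: fin_num_measure.
Qed.

End finite_square_integrable.

(** * Tensor products on powers of a measure space *)

Section product_square_integrable.
Context d1 d2 (T1 : measurableType d1) (T2 : measurableType d2) (R : realType).
Variables (m1 : {finite_measure set T1 -> \bar R}).
Variables (m2 : {finite_measure set T2 -> \bar R}).

Lemma integrable_prodM (f : T1 -> R) (g : T2 -> R) :
  m1.-integrable setT (EFin \o f) -> m2.-integrable setT (EFin \o g) ->
  (m1 \x m2)%E.-integrable setT (EFin \o (fun p => f p.1 * g p.2)).
Proof.
move=> /integrableP[mf intf] /integrableP[mg intg].
have {}mf := (measurable_EFinP _ _).1 mf; have {}mg := (measurable_EFinP _ _).1 mg.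
apply/integrable12ltyP.
  apply/measurable_EFinP; apply: measurable_funM.
    by apply: (measurableT_comp mf).
  by apply: (measurableT_comp mg).
under eq_integral => x _.
  under eq_integral => y _ do rewrite /= normrM EFinM.
  rewrite ge0_integralZl//; last by apply/measurable_EFinP; exact: measurableT_comp.
  over.
rewrite /= ge0_integralZr//.
- apply: lte_mul_pinfty => //; first exact: integral_ge0.
  by rewrite ge0_fin_numE//; exact: integral_ge0.
- by apply/measurable_EFinP; exact: measurableT_comp.
- exact: integral_ge0.
Qed.

Lemma Rintegral_prodM (f : T1 -> R) (g : T2 -> R) :
  m1.-integrable setT (EFin \o f) -> m2.-integrable setT (EFin \o g) ->
  \int[(m1 \x m2)%E]_p (f p.1 * g p.2) = \int[m1]_x f x * \int[m2]_y g y.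
Proof.
move=> intf intg; rewrite /Rintegral.
rewrite -integral12_prod_meas1; last exact: integrable_prodM.
rewrite -fineM; [|exact: integrable_fin_num..].
congr fine; rewrite -[X in (_ * X)%E]fineK; last exact: integrable_fin_num.
rewrite -integralZr// fineK; last exact: integrable_fin_num.
apply: eq_integral => x _; rewrite /fubini_F -integralZl//.
Qed.

Lemma L2_prodM (f : T1 -> R) (g : T2 -> R) : L2 m1 f -> L2 m2 g ->
  L2 (m1 \x m2)%E (fun p => f p.1 * g p.2).
Proof.
move=> L2f L2g; apply/L2P; split.
  apply: measurable_funM.
    by apply: (measurableT_comp (L2_measurable L2f)).
  by apply: (measurableT_comp (L2_measurable L2g)).
under eq_fun do rewrite mulrACA.
exact: (integrable_prodM (L2_integrableM L2f L2f) (L2_integrableM L2g L2g)).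
Qed.

Lemma inner_prodM (f f' : T1 -> R) (g g' : T2 -> R) :
  L2 m1 f -> L2 m1 f' -> L2 m2 g -> L2 m2 g' ->
  inner (m1 \x m2)%E (fun p => f p.1 * g p.2) (fun p => f' p.1 * g' p.2) =
  inner m1 f f' * inner m2 g g'.
Proof.
move=> L2f L2f' L2g L2g'; rewrite /inner.
rewrite -Rintegral_prodM; [|exact: L2_integrableM..].
by apply: eq_Rintegral => p _; rewrite mulrACA.
Qed.

End product_square_integrable.

Section tensor.
Context d (V : measurableType d) (R : realType).
Variable mu : {finite_measure set V -> \bar R}.

Lemma integrable_mpowS n (f : n.+1.-tuple V -> R) : measurable_fun setT f ->
  (mu \x mpow mu n)%E.-integrable setT (EFin \o (f \o @tcons _ V n)) <->
  (mpow mu n.+1).-integrable setT (EFin \o f).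
Proof.
move=> mf; have mEf : measurable_fun setT (EFin \o f) by exact/measurable_EFinP.
split=> /integrableP[_ fin]; apply/integrableP; split => //.
- rewrite [ltLHS](ge0_integral_pushforward (@measurable_tcons _ V n))//.
  exact/measurableT_comp.
- by apply/measurable_EFinP/measurableT_comp => //; exact: measurable_tcons.
- rewrite [ltLHS](ge0_integral_pushforward (@measurable_tcons _ V n))// in fin.
  exact/measurableT_comp.
Qed.

Lemma integral_mpowS n (f : n.+1.-tuple V -> R) :
  (mpow mu n.+1).-integrable setT (EFin \o f) ->
  (\int[mpow mu n.+1]_t (f t)%:E = \int[mu \x mpow mu n]_p (f (tcons p))%:E)%E.
Proof.
move=> intf; have mf : measurable_fun setT f.
  by apply/measurable_EFinP; case/integrableP: intf.
apply: (integral_pushforward (@measurable_tcons _ V n) _ _ measurableT).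
- by apply/measurable_EFinP.
- by rewrite preimage_setT; exact/integrable_mpowS.
Qed.

Lemma Rintegral_mpowS n (f : n.+1.-tuple V -> R) :
  (mpow mu n.+1).-integrable setT (EFin \o f) ->
  \int[mpow mu n.+1]_t f t = \int[(mu \x mpow mu n)%E]_p f (tcons p).
Proof. by move=> intf; rewrite /Rintegral integral_mpowS. Qed.

Definition tensor n (g : 'I_n -> V -> R) (t : n.-tuple V) : R :=
  \prod_(i < n) g i (tnth t i).

Lemma tensor_tcons n (g : 'I_n.+1 -> V -> R) p :
  tensor g (tcons p) = g ord0 p.1 * tensor (fun i => g (lift ord0 i)) p.2.
Proof.
rewrite /tensor big_ord_recl tnth0; congr (_ * _).
by apply: eq_bigr => i _; rewrite tnthS.
Qed.

Lemma measurable_tensor n (g : 'I_n -> V -> R) :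
  (forall i, measurable_fun setT (g i)) -> measurable_fun setT (tensor g).
Proof.
move=> mg; apply: measurable_prod => i _.
by apply: (measurableT_comp (mg i)); exact: measurable_tnth.
Qed.

(** Integrability and value are proved together: the Fubini step for the value
    needs the integrability of the remaining factors. *)
Lemma tensor_integral n (g : 'I_n -> V -> R) :
  (forall i, mu.-integrable setT (EFin \o g i)) ->
  (mpow mu n).-integrable setT (EFin \o tensor g) /\
  \int[mpow mu n]_t tensor g t = \prod_(i < n) \int[mu]_x g i x.
Proof.
elim: n g => [|n IH] g ig.
  have -> : tensor g = cst 1 by apply/funext => t; rewrite /tensor big_ord0.
  split; first exact: finite_measure_integrable_cst.
  rewrite Rintegral_cst// big_ord0 mul1r.
  transitivity (fine (\d_([tuple] : 0.-tuple V) setT) : R) => //.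
  by rewrite diracT.
have mg i : measurable_fun setT (g i).
  by apply/measurable_EFinP; case/integrableP: (ig i).
have [IH1 IH2] := IH (fun i => g (lift ord0 i)) (fun i => ig (lift ord0 i)).
have ipr := integrable_prodM (ig ord0) IH1.
have int : (mpow mu n.+1).-integrable setT (EFin \o tensor g).
  apply/integrable_mpowS; first exact: measurable_tensor.
  by rewrite (_ : _ \o _ = fun p => g ord0 p.1 *
    tensor (fun i => g (lift ord0 i)) p.2)//; apply/funext => p; exact: tensor_tcons.
split => //; rewrite Rintegral_mpowS// big_ord_recl -IH2 -Rintegral_prodM//.
by apply: eq_Rintegral => p _; rewrite tensor_tcons.
Qed.

Lemma tensorM n (f g : 'I_n -> V -> R) t :
  tensor f t * tensor g t = tensor (fun i x => f i x * g i x) t.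
Proof. by rewrite /tensor -big_split. Qed.

Lemma L2_tensor n (g : 'I_n -> V -> R) : (forall i, L2 mu (g i)) ->
  L2 (mpow mu n) (tensor g).
Proof.
move=> L2g; apply/L2P; split.
  by apply: measurable_tensor => i; exact: L2_measurable.
under eq_fun do rewrite tensorM.
by apply: (tensor_integral _).1 => i; exact: L2_integrableM.
Qed.

Lemma inner_tensor n (f g : 'I_n -> V -> R) :
  (forall i, L2 mu (f i)) -> (forall i, L2 mu (g i)) ->
  inner (mpow mu n) (tensor f) (tensor g) = \prod_(i < n) inner mu (f i) (g i).
Proof.
move=> L2f L2g; rewrite /inner; under eq_Rintegral do rewrite tensorM.
by apply: (tensor_integral _).2 => i; exact: L2_integrableM.
Qed.

Lemma tensor_indic n (B : 'I_n -> set V) :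
  tensor (fun i => \1_(B i)) = \1_[set t | forall i, B i (tnth t i)] :> (_ -> R).
Proof.
apply/funext => t; rewrite indicE /tensor.
have [Bt|nBt] := asboolP (forall i, B i (tnth t i)).
  rewrite mem_set// big1// => i _; rewrite indicE mem_set//; exact: Bt.
rewrite memNset//; move/existsNP: nBt => [i Bi].
by rewrite (bigD1 i)//= indicE memNset// mul0r.
Qed.

Lemma measurable_box n (B : 'I_n -> set V) : (forall i, measurable (B i)) ->
  measurable [set t : n.-tuple V | forall i, B i (tnth t i)].
Proof.
move=> mB; rewrite (_ : mkset _ = \bigcap_i ((@tnth n V)^~ i @^-1` B i)).
  apply: fin_bigcap_measurable => // i _.
  by rewrite -[X in measurable X]setTI; exact: measurable_tnth.
by apply/seteqP; split => t h i //=; exact: h.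
Qed.

End tensor.

(** * The quadratic form of the integrated kernel *)

Section pairing.
Context d (V : measurableType d) (R : realType).
Variables (mu : {finite_measure set V -> \bar R}) (n : nat).
Local Notation muk := (mpow mu n.+2).

(** The tensor of this family takes the value g(x) h(y) at (x, y, v), so that
    pairing A with it evaluates the bilinear form of the kernel obtained from A
    by integrating out v. *)
Definition pair_fun (g h : V -> R) (i : 'I_n.+2) : V -> R :=
  if val i is i'.+1 then (if i' is _.+1 then cst 1 else h) else g.

Definition pair_form (A : n.+2.-tuple V -> R) (g h : V -> R) : R :=
  inner muk A (tensor (pair_fun g h)).

Lemma L2_pair_fun g h i : L2 mu g -> L2 mu h -> L2 mu (pair_fun g h i).
Proof.
move=> L2g L2h; rewrite /pair_fun; case: (val i) => [//|[//|?]].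
exact: L2_cst.
Qed.

Lemma tensor_pair g h x y v :
  tensor (pair_fun g h) (tcons (x, tcons (y, v))) = g x * h y.
Proof.
by rewrite !tensor_tcons/= /tensor big1// mulr1.
Qed.

Lemma tcons_cons2 (x y : V) (v : n.-tuple V) :
  tcons (x, tcons (y, v)) = @cons2 _ V n.+2 x y v.
Proof.
apply: eq_from_tnth => i; rewrite tnth_mktuple (tnth_nth x).
by [].
Qed.

(** Fubini. The kernel [Tstar mu A] is a real-valued integral and is meaningful
    only where the slice of A is integrable; this is the case almost everywhere
    because A, being square-integrable for a finite measure, is integrable. *)
Lemma inner_Tstar (A : n.+2.-tuple V -> R) g h : L2 muk A ->
  L2 (mu \x mu)%E (Tstar mu A) -> L2 mu g -> L2 mu h ->
  inner (mu \x mu)%E (Tstar mu A) (fun p => g p.1 * h p.2) = pair_form A g h.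
Proof.
move=> L2A L2K L2g L2h.
have L2gh := L2_tensor (fun i => L2_pair_fun i L2g L2h).
have iF := L2_integrableM L2A L2gh.
have iG := L2_integrableM L2K (L2_prodM L2g L2h).
rewrite /pair_form /inner /Rintegral integral_mpowS//.
have iF' := iF; move/integrable_mpowS in iF'.
have {}iF' := iF' (measurable_funM (L2_measurable L2A) (L2_measurable L2gh)).
have iA' := L2_integrable L2A; move/integrable_mpowS in iA'.
have {}iA' := iA' (L2_measurable L2A).
rewrite -integral12_prod_meas1//= -integral12_prod_meas1//; congr fine.
apply: ae_eq_integral => //.
- exact: (measurable_fubini_F iG).
- exact: (measurable_fubini_F iF').
apply: filterS2 (ae_integrable1 iF') (ae_integrable1 iA') => x iFx iAx _.
rewrite /fubini_F.
have iFx' := iFx; have iAx' := iAx.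
move/integrable_mpowS in iFx'; move/integrable_mpowS in iAx'.
have mA := measurable_int _ iAx; have mF := measurable_int _ iFx.
move/measurable_EFinP in mA; move/measurable_EFinP in mF.
have {}iFx' := iFx' mF; have {}iAx' := iAx' mA.
have := integral_mpowS iFx => /= ->.
rewrite -integral12_prod_meas1//; apply: ae_eq_integral => //.
- have /measurable_int/= mG := iG.
  exact: (measurableT_comp mG (pair1_measurable x)).
- exact: (measurable_fubini_F iFx').
apply: filterS (ae_integrable1 iAx') => y iAxy _.
rewrite /fubini_F/= /Tstar/=.
under [RHS]eq_integral => v _ do
  rewrite tcons_cons2 -tcons_cons2 tensor_pair EFinM.
rewrite integralZr//.
rewrite EFinM; congr (_ * _)%E.
rewrite /Rintegral; under eq_integral do rewrite -tcons_cons2.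
by rewrite fineK//; exact: integrable_fin_num.
Qed.

End pairing.

(** * Conic approximation *)

Section cone_approximation.
Context d (V : measurableType d) (R : realType).
Variables (mu : {finite_measure set V -> \bar R}) (k : nat).
Local Notation muk := (mpow mu k).

Lemma L2_tensor_pow (f : V -> R) : L2 mu f -> L2 muk (tensor_pow (k := k) f).
Proof. by move=> L2f; exact: (@L2_tensor _ _ _ mu k (fun=> f)). Qed.

Lemma inner_tensor_pow (f : V -> R) (g : 'I_k -> V -> R) : L2 mu f ->
  (forall i, L2 mu (g i)) ->
  inner muk (tensor_pow (k := k) f) (tensor g) = \prod_(i < k) inner mu f (g i).
Proof. by move=> L2f L2g; exact: (@inner_tensor _ _ _ mu k (fun=> f)). Qed.

(** The same approximant serves all test functions, with an error linear in
    their norm, so that it can be tested on all cells of a partition at once. *)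
Lemma CP_approx (A : k.-tuple V -> R) (e : R) : CP mu k A -> 0 < e ->
  exists (n : nat) (c : 'I_n -> R) (f : 'I_n -> V -> R),
    (forall i, [/\ 0 <= c i, L2 mu (f i) & forall x, 0 <= f i x]) /\
    forall G, L2 muk G ->
      `|inner muk A G - \sum_(i < n) c i * inner muk (tensor_pow (f i)) G| <=
      e * Num.sqrt (inner muk G G).
Proof.
move=> [[L2A _] approx] e0; have [n [c [f [cf Af]]]] := approx e e0.
exists n, c, f; split => // G L2G.
have L2f i : L2 muk (tensor_pow (f i)) by apply: L2_tensor_pow; case: (cf i).
have L2S : L2 muk (fun t => \sum_(i < n) c i * tensor_pow (f i) t).
  by apply: (@L2_sum _ _ _ _ _ _ (fun i t => c i * tensor_pow (f i) t)) => i;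
    exact: L2Z.
rewrite -inner_suml// -innerBl//.
apply: le_trans (norm_inner_le (L2B L2A L2S) L2G) _.
by rewrite ler_wpM2r ?sqrtr_ge0// ltW// inner_lt_norm2//; exact: L2B.
Qed.

End cone_approximation.

Section pair_form_cone.
Context d (V : measurableType d) (R : realType).
Variables (mu : {finite_measure set V -> \bar R}) (n : nat).
Local Notation muk := (mpow mu n.+2).
Variable A : n.+2.-tuple V -> R.
Hypothesis CPA : CP mu n.+2 A.

Lemma inner_tensor_pow_pair (f g h : V -> R) : L2 mu f -> L2 mu g -> L2 mu h ->
  inner muk (tensor_pow f) (tensor (pair_fun g h)) =
  inner mu f g * inner mu f h * inner mu f (cst 1) ^+ n.
Proof.
move=> L2f L2g L2h; rewrite inner_tensor_pow//; last first.
  by move=> i; exact: L2_pair_fun.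
rewrite !big_ord_recl/= mulrA; congr (_ * _).
by rewrite -[X in _ ^+ X](card_ord n) -prodr_const; exact: eq_big.
Qed.

(** On a conic combination the form is a combination of the products
    <f, g> <f, h> <f, 1>^n with nonnegative coefficients, where symmetry is evident;
    it passes to the limit, as does positivity in the next lemma. *)
Lemma pair_formC (g h : V -> R) : L2 mu g -> L2 mu h ->
  pair_form mu A g h = pair_form mu A h g.
Proof.
move=> L2g L2h; apply/eqP; rewrite -subr_eq0 -normr_le0 /pair_form.
set G := tensor (pair_fun g h); set H := tensor (pair_fun h g).
have L2G : L2 muk G by apply: L2_tensor => i; exact: L2_pair_fun.
have L2H : L2 muk H by apply: L2_tensor => i; exact: L2_pair_fun.
set S := Num.sqrt (inner muk G G) + Num.sqrt (inner muk H H) + 1.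
have S0 : 0 < S by rewrite ltr_wpDl// addr_ge0// sqrtr_ge0.
apply/ler_addgt0Pl => e e0; rewrite addr0.
have [|m [c [f [cf approx]]]] := @CP_approx _ _ _ mu _ A (e / S) CPA.
  exact: divr_gt0.
have := approx _ L2G; have := approx _ L2H.
have -> : \sum_(i < m) c i * inner muk (tensor_pow (f i)) H =
    \sum_(i < m) c i * inner muk (tensor_pow (f i)) G.
  apply: eq_bigr => i _; have [_ L2f _] := cf i.
  by rewrite !inner_tensor_pow_pair// [inner mu (f i) h * _]mulrC.
move=> hH hG.
apply: le_trans (ler_distD (\sum_(i < m) c i * inner muk (tensor_pow (f i)) G) _ _) _.
rewrite [X in _ + X]distrC; apply: le_trans (lerD hG hH) _.
rewrite -mulrDr -mulrA ler_piMr//; first exact: ltW.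
by rewrite mulrC ler_pdivrMr// mul1r lerDl.
Qed.

Lemma pair_form_ge0 (g : V -> R) : L2 mu g -> 0 <= pair_form mu A g g.
Proof.
move=> L2g; rewrite -oppr_le0 /pair_form.
set G := tensor (pair_fun g g).
have L2G : L2 muk G by apply: L2_tensor => i; exact: L2_pair_fun.
set S := Num.sqrt (inner muk G G) + 1.
have S0 : 0 < S by rewrite ltr_wpDl// sqrtr_ge0.
apply/ler_addgt0Pl => e e0; rewrite addr0.
have [|m [c [f [cf approx]]]] := @CP_approx _ _ _ mu _ A (e / S) CPA.
  exact: divr_gt0.
have := approx _ L2G; rewrite ler_distl => /andP[+ _].
have : 0 <= \sum_(i < m) c i * inner muk (tensor_pow (f i)) G.
  apply: sumr_ge0 => i _; have [c0 L2f f0] := cf i.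
  rewrite mulr_ge0// inner_tensor_pow_pair// mulr_ge0//.
    by rewrite -expr2 sqr_ge0.
  by rewrite exprn_ge0//; apply: Rintegral_ge0 => x _; rewrite mulr1.
have : e / S * Num.sqrt (inner muk G G) <= e.
  rewrite -mulrA ler_piMr//; first exact: ltW.
  by rewrite mulrC ler_pdivrMr// mul1r lerDl.
lra.
Qed.

End pair_form_cone.

(** * Step functions *)

Section step_functions.
Context d (V : measurableType d) (R : realType).
Variables (mu : {finite_measure set V -> \bar R}) (T : finType) (p : V -> T).
Hypothesis mp : forall j, measurable (p @^-1` [set j]).

Local Notation cell j := (p @^-1` [set j]).
Local Notation mass j := (fine (mu (cell j))).

Lemma stepE (x : T -> R) v : x (p v) = \sum_j x j * \1_(cell j) v.
Proof.
rewrite (bigD1 (p v))//= indicE mem_set// mulr1 big1 ?addr0// => j jpv.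
rewrite indicE memNset ?mulr0//= => pvj; move: jpv.
by rewrite pvj eqxx.
Qed.

Lemma L2_cell j : L2 mu (\1_(cell j) : V -> R).
Proof. exact: L2_indic. Qed.

Lemma L2_step (x : T -> R) : L2 mu (x \o p).
Proof.
have -> : x \o p = fun v => \sum_j x j * \1_(cell j) v.
  by apply/funext => v; exact: stepE.
by apply: L2_sum => j; apply: L2Z; exact: L2_cell.
Qed.

Lemma inner_stepl (x : T -> R) g : L2 mu g ->
  inner mu (x \o p) g = \sum_j x j * inner mu g (\1_(cell j)).
Proof.
move=> L2g; have -> : x \o p = fun v => \sum_j x j * \1_(cell j) v.
  by apply/funext => v; exact: stepE.
rewrite inner_suml//; last exact: L2_cell.
by apply: eq_bigr => j _; rewrite innerC.
Qed.

Lemma inner_step_cell (x : T -> R) j : inner mu (x \o p) (\1_(cell j)) = x j * mass j.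
Proof.
rewrite inner_stepl; last exact: L2_cell.
rewrite (bigD1 j)//= inner_indic// setIid big1 ?addr0// => i ij.
rewrite inner_indic// (_ : _ `&` _ = set0) ?measure0 ?mulr0//.
by apply/seteqP; split => // v [/= pvj pvi]; move: ij; rewrite -pvi -pvj eqxx.
Qed.

Lemma inner_step (x y : T -> R) :
  inner mu (x \o p) (y \o p) = \sum_j x j * y j * mass j.
Proof.
rewrite inner_stepl; last exact: L2_step.
by apply: eq_bigr => j _; rewrite inner_step_cell mulrA.
Qed.

(** The difference of the two sides is the squared distance from u to its
    orthogonal projection on the step functions; the convention 0^-1 = 0 makes
    null cells contribute nothing. *)
Lemma bessel_cells u : L2 mu u ->
  \sum_j inner mu u (\1_(cell j)) ^+ 2 / mass j <= inner mu u u.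
Proof.
move=> L2u; set a := fun j => inner mu u (\1_(cell j)).
have L2P := L2_step (fun j => a j / mass j).
have := inner_ge0 mu (fun v => u v - (a (p v) / mass (p v))).
rewrite innerBl//; last exact: L2B.
rewrite [inner mu u _]innerC [inner mu (fun x => a _ / _) _]innerC !innerBl//.
rewrite [inner mu u (fun x => a _ / _)]innerC.
rewrite -/((fun j => a j / mass j) \o p) inner_step inner_stepl//.
rewrite (_ : \sum_j a j / mass j * (a j / mass j) * mass j =
             \sum_j a j ^+ 2 / mass j); last first.
  apply: eq_bigr => j _; have [->|m0] := eqVneq (mass j) 0.
    by rewrite invr0 !mulr0.
  by field.
rewrite (_ : \sum_j a j / mass j * inner mu u (\1_(cell j)) =
             \sum_j a j ^+ 2 / mass j); last first.
  by apply: eq_bigr => j _; rewrite -/(a j); ring.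
rewrite subrr subr0 subr_ge0; exact.
Qed.

End step_functions.

(** * The trace of a positive kernel *)

Section positive_trace.
Context d (V : measurableType d) (R : realType).
Variable mu : {finite_measure set V -> \bar R}.
Variables (K : V * V -> R) (s : nat -> R) (u v : nat -> V -> R).
Hypotheses (L2K : L2 (mu \x mu)%E K) (svd : singular_decomposition mu K s u v).

Local Notation form g h := (inner (mu \x mu)%E K (fun p => g p.1 * h p.2)).

Let L2u i : L2 mu (u i). Proof. by case: svd => _ /(_ i)[]. Qed.
Let L2v i : L2 mu (v i). Proof. by case: svd => _ /(_ i)[]. Qed.

Lemma svd_form (g h : V -> R) : L2 mu g -> L2 mu h ->
  \sum_(i < n) s i * (inner mu (u i) g * inner mu (v i) h) @[n --> \oo] -->
  form g h.
Proof.
move=> L2g L2h; case: svd => _ _ _ cvK.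
set G : V * V -> R := fun p => g p.1 * h p.2.
have L2G : L2 (mu \x mu)%E G by exact: L2_prodM.
pose S n p : R := \sum_(i < n) s i * (u i p.1 * v i p.2).
have L2uv i : L2 (mu \x mu)%E (fun p => u i p.1 * v i p.2) by exact: L2_prodM.
have L2S n : L2 (mu \x mu)%E (S n).
  by apply: (@L2_sum _ _ _ _ _ _ (fun (i : 'I_n) p => s i * (u i p.1 * v i p.2))) => i;
    exact: L2Z.
have SE n : inner (mu \x mu)%E (S n) G =
    \sum_(i < n) s i * (inner mu (u i) g * inner mu (v i) h).
  rewrite (@inner_suml _ _ _ _ _ _ (fun i : 'I_n => s i)
    (fun (i : 'I_n) p => u i p.1 * v i p.2))//.
  by apply: eq_bigr => i _; rewrite inner_prodM.
under eq_cvg do rewrite -SE.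
have {}cvK : Num.sqrt (inner (mu \x mu)%E (fun p => K p - S n p)
    (fun p => K p - S n p)) @[n --> \oo] --> (0 : R).
  move: cvK; under eq_cvg => n.
    rewrite (_ : norm2 _ _ = (Num.sqrt (inner (mu \x mu)%E (fun p => K p - S n p)
    (fun p => K p - S n p)))%:E); last first.
      rewrite -norm2E; last exact: L2B.
      congr norm2; apply/funext => p; congr (_ - _).
      by apply: eq_bigr => i _; rewrite mulrA.
    over.
  by move/fine_cvgP => [].
apply/cvgrPdist_le => e e0.
set N := Num.sqrt (inner (mu \x mu)%E G G) + 1.
have N0 : 0 < N by rewrite ltr_wpDl// sqrtr_ge0.
move/cvgrPdist_le: cvK => /(_ (e / N) (divr_gt0 e0 N0)).
apply: filterS => n; rewrite sub0r normrN ger0_norm ?sqrtr_ge0// => hn.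
rewrite -innerBl//; apply: le_trans (norm_inner_le (L2B L2K (L2S n)) L2G) _.
apply: le_trans (ler_wpM2r (sqrtr_ge0 _) hn) _.
rewrite -mulrA ler_piMr//; first exact: ltW.
by rewrite mulrC ler_pdivrMr// mul1r lerDl.
Qed.

Lemma svd_form_left i h : s i != 0 -> L2 mu h ->
  form (u i) h = s i * inner mu (v i) h.
Proof.
move=> si L2h; apply: (cvg_unique _ (svd_form (L2u i) L2h)) => //.
apply: cvg_near_cst; exists i.+1 => // n /= lin.
rewrite (bigD1 (Ordinal lin))//= big1 ?addr0.
  by case: svd => _ _ /(_ i i si si)[-> _] _; rewrite eqxx mul1r.
move=> j ji; have [->|sj] := eqVneq (s j) 0; first by rewrite mul0r.
case: svd => _ _ /(_ j i sj si)[-> _] _.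
by rewrite (_ : (val j == i) = false) ?mul0r ?mulr0//; apply/negbTE.
Qed.

Lemma svd_form_right i g : s i != 0 -> L2 mu g ->
  form g (v i) = s i * inner mu (u i) g.
Proof.
move=> si L2g; apply: (cvg_unique _ (svd_form L2g (L2v i))) => //.
apply: cvg_near_cst; exists i.+1 => // n /= lin.
rewrite (bigD1 (Ordinal lin))//= big1 ?addr0.
  by case: svd => _ _ /(_ i i si si)[_ ->] _; rewrite eqxx mulr1.
move=> j ji; have [->|sj] := eqVneq (s j) 0; first by rewrite mul0r.
case: svd => _ _ /(_ j i sj si)[_ ->] _.
by rewrite (_ : (val j == i) = false) ?mulr0//; apply/negbTE.
Qed.

Hypothesis formC : forall g h, L2 mu g -> L2 mu h -> form g h = form h g.
Hypothesis form_ge0 : forall g, L2 mu g -> 0 <= form g g.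

(** For w = u_i - v_i the form takes the value 2 s_i (<u_i, v_i> - 1), so
    positivity forces <u_i, v_i> >= 1: the trace is the sum of the singular
    values. *)
Lemma singular_vectors_agree i : s i <= s i * inner mu (u i) (v i).
Proof.
have [->|si] := eqVneq (s i) 0; first by rewrite mul0r.
have s_ge0 : 0 <= s i by case: svd.
have s0 : 0 < s i by rewrite lt_neqAle eq_sym si.
have uu : inner mu (u i) (u i) = 1.
  by case: svd => _ _ /(_ i i si si)[-> _] _; rewrite eqxx.
have := form_ge0 (L2B (L2u i) (L2v i)).
have L2p g h : L2 mu g -> L2 mu h -> L2 (mu \x mu)%E (fun p => g p.1 * h p.2).
  exact: L2_prodM.
rewrite (_ : (fun p => _) = (fun p => (u i p.1 * u i p.2 - u i p.1 * v i p.2) -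
   (v i p.1 * u i p.2 - v i p.1 * v i p.2))); last by apply/funext => p; ring.
rewrite innerC !innerBl//; try by repeat apply: L2B; exact: L2p.
rewrite ![inner _ _ K]innerC [form (v i) (u i)]formC//.
rewrite (svd_form_left si (L2u i)) (svd_form_left si (L2v i)).
rewrite (svd_form_right si (L2v i)).
rewrite [inner mu (v i) (u i)]innerC.
have -> : inner mu (v i) (v i) = 1.
  by case: svd => _ _ /(_ i i si si)[_ ->] _; rewrite eqxx.
nra.
Qed.

(** The left side is the trace of the compression of the kernel to the step
    functions. By Bessel's inequality each singular pair contributes at most s_i
    to it, and the s_i sum to at most the trace. *)
Lemma trace_cells (T : finType) (p : V -> T) :
  (forall j, measurable (p @^-1` [set j])) ->
  series (fun i => s i * inner mu (u i) (v i)) @ \oo --> (1 : R) ->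
  \sum_j form (\1_(p @^-1` [set j]) : V -> R) (\1_(p @^-1` [set j]) : V -> R) /
    fine (mu (p @^-1` [set j])) <= 1.
Proof.
move=> mp cv1; set cell := fun j => p @^-1` [set j].
have L2c j : L2 mu (\1_(cell j) : V -> R) by exact: (L2_indic mu (mp j)).
pose q i j := inner mu (u i) (\1_(cell j)) * inner mu (v i) (\1_(cell j)) /
  fine (mu (cell j)).
have q1 i : s i * \sum_j q i j <= s i * inner mu (u i) (v i).
  apply: le_trans (singular_vectors_agree i).
  have s_ge0 : 0 <= s i by case: svd.
  have [->|si] := eqVneq (s i) 0; first by rewrite mul0r.
  rewrite ler_piMr//.
  have := bessel_cells mp (L2u i); have := bessel_cells mp (L2v i).
  case: svd => _ _ /(_ i i si si)[-> ->] _; rewrite eqxx => bv bu.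
  have : \sum_j (2 * q i j) <=
      \sum_j (inner mu (u i) (\1_(cell j)) ^+ 2 / fine (mu (cell j)) +
              inner mu (v i) (\1_(cell j)) ^+ 2 / fine (mu (cell j))).
    apply: ler_sum => j _; rewrite /q.
    have : 0 <= (fine (mu (cell j)))^-1 by rewrite invr_ge0 fine_ge0.
    move: (_^-1) => w w0; rewrite -mulrDl mulrA ler_wpM2r//.
    rewrite -subr_ge0; set a := inner mu _ _; set b := inner mu _ _.
    by rewrite (_ : _ - _ = (a - b) ^+ 2) ?sqr_ge0//; ring.
  rewrite -mulr_sumr big_split/= => h.
  by have := le_trans h (lerD bu bv); rewrite mulr1n; lra.
apply: (ler_cvg_to _ cv1 (f := fun n => \sum_(i < n) s i * \sum_j q i j)).
  have -> : (fun n => \sum_(i < n) s i * \sum_j q i j) =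
      fun n => \sum_j (\sum_(i < n) s i * (inner mu (u i) (\1_(cell j)) *
        inner mu (v i) (\1_(cell j)))) / fine (mu (cell j)).
    apply/funext => n; rewrite [LHS](eq_bigr (fun i : 'I_n => \sum_j s i * q i j)).
      rewrite exchange_big/=; apply: eq_bigr => j _; rewrite mulr_suml.
      by apply: eq_bigr => i _; rewrite /q !mulrA.
    by move=> i _; rewrite mulr_sumr.
  apply: cvg_big => [|j _]; first exact: add_continuous.
  apply: cvgMr_tmp.
  exact: svd_form.
near=> n; rewrite /series/= big_mkord; apply: ler_sum => i _; exact: q1.
Unshelve. all: by end_near.
Qed.

End positive_trace.

(** * Approximation by finite unions of boxes *)

Lemma measure_tail_cvg0 d (T : measurableType d) (R : realType)
    (m : {finite_measure set T -> \bar R}) (F : (set T)^nat) :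
  (forall n, measurable (F n)) ->
  m (\bigcup_k F k `\` \bigcup_(i < n) F i) @[n --> \oo] --> 0%E.
Proof.
move=> mF; set U := \bigcup_k F k.
have mU : measurable U by exact: bigcup_measurable.
have mt n : measurable (U `\` \bigcup_(i < n) F i).
  by apply: measurableD => //; apply: bigcup_measurable.
have cap0 : \bigcap_n (U `\` \bigcup_(i < n) F i) = set0.
  apply/seteqP; split => // x /= capx; have [[k _ Fkx] _] := capx 0%N I.
  by have [_] := capx k.+1 I; apply; exists k => /=.
rewrite -(measure0 m) -cap0; apply: nonincreasing_cvg_mu => //.
- by rewrite ltey_eq fin_num_measure.
- by rewrite cap0.
- move=> a b ab; apply/subsetPset => x [Ux nx]; split => // -[i /= ia Fi].
  by apply: nx; exists i => //=; exact: leq_trans ab.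
Qed.

Section cylinders.
Context d (V : measurableType d) (R : realType) (k : nat).
Implicit Types W : set (k.-tuple V).

(** A finite partition is encoded by a map to a finite type, so that a pair of maps
    is a common refinement; the predicate selects boxes with cells as sides. *)
Definition cylinder (T : finType) (p : V -> T) (S : pred (k.-tuple T)) :
  set (k.-tuple V) := [set t | S (map_tuple p t)].

Definition cell_box (T : finType) (p : V -> T) (s : k.-tuple T) :
    set (k.-tuple V) :=
  [set t | forall i, (p @^-1` [set tnth s i]) (tnth t i)].

Lemma cell_boxE (T : finType) (p : V -> T) (s : k.-tuple T) t :
  cell_box p s t <-> map_tuple p t = s.
Proof.
split=> [h|<- i /=]; last by rewrite tnth_map.
by apply: eq_from_tnth => i; rewrite tnth_map; exact: h.
Qed.

Lemma measurable_cylinder (T : finType) (p : V -> T) S :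
  (forall j, measurable (p @^-1` [set j])) -> measurable (cylinder p S).
Proof.
move=> mp; rewrite (_ : cylinder p S = \bigcup_(s in [set s | S s]) cell_box p s).
  apply: fin_bigcup_measurable => [|s _]; first exact: finite_finset.
  by apply: (@measurable_box _ _ _ (fun i => p @^-1` [set tnth s i])) => i; exact: mp.
apply/seteqP; split => [t St|t [s /= Ss /cell_boxE ts]].
  by exists (map_tuple p t) => //; exact/cell_boxE.
by rewrite /cylinder/= ts.
Qed.

Lemma indic_cylinder (T : finType) (p : V -> T) S t :
  \1_(cylinder p S) t =
  \sum_(s | S s) tensor (fun i => \1_(p @^-1` [set tnth s i])) t :> R.
Proof.
under eq_bigr do rewrite tensor_indic.
have E s : (\1_(cell_box p s) t : R) = (map_tuple p t == s)%:R.
  rewrite indicE; have [ts|ts] := eqVneq (map_tuple p t) s.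
    by rewrite mem_set//; exact/cell_boxE.
  by rewrite memNset// => /cell_boxE; exact/eqP.
rewrite indicE; have [St|nSt] := boolP (S (map_tuple p t)).
  rewrite mem_set// (bigD1 (map_tuple p t))//= E eqxx big1 ?addr0// => s.
  by rewrite E eq_sym => /andP[_ /negbTE ->].
rewrite memNset//; last by rewrite /cylinder/= (negbTE nSt).
rewrite big1// => s Ss; rewrite E (_ : _ == s = false)//.
by apply/negbTE; apply: contra nSt => /eqP ->.
Qed.

Definition approximable (m : {finite_measure set (k.-tuple V) -> \bar R}) W :=
  forall e : R, 0 < e -> exists (T : finType) (p : V -> T) (S : pred (k.-tuple T)),
    (forall j, measurable (p @^-1` [set j])) /\
    (m (W `+` cylinder p S) < e%:E)%E.

Let box (B : 'I_k -> set V) := [set t : k.-tuple V | forall i, B i (tnth t i)].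

Lemma tuple_measurableE : @measurable _ (k.-tuple V) =
  <<s [set box B | B in [set B | forall i, measurable (B i)]] >>.
Proof.
apply/seteqP; split; last first.
  apply: smallest_sub; first exact: sigma_algebra_measurable.
  by move=> _ [B mB <-]; exact: measurable_box.
apply: smallest_sub; first exact: smallest_sigma_algebra.
apply: (big_ind (fun G => G `<=` _)) => //; first by move=> X Y HX HY A [/HX|/HY].
move=> i _ A [B mB <-]; apply: sub_sigma_algebra.
exists (fun j => if j == i then B else setT).
  by move=> j; case: ifP.
rewrite setTI; apply/seteqP; split => t /=.
  by move/(_ i); rewrite eqxx.
by move=> Bt j; case: eqP => // ->.
Qed.

Lemma symdiff_lt (m : {finite_measure set (k.-tuple V) -> \bar R}) A B C (a b : R) :
  measurable A -> measurable B -> measurable C ->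
  (m (A `+` B) < a%:E)%E -> (m (B `+` C) < b%:E)%E -> (m (A `+` C) < (a + b)%:E)%E.
Proof.
move=> mA mB mC ltAB ltBC.
have mY (X Y : set (k.-tuple V)) :
    measurable X -> measurable Y -> measurable (X `+` Y).
  by move=> ? ?; rewrite setY_def; apply: measurableU; exact: measurableD.
apply: (@le_lt_trans _ _ (m ((A `+` B) `|` (B `+` C)))).
  apply: le_measure; rewrite ?inE//; [exact: mY| |].
    by apply: measurableU; exact: mY.
  by move=> t /=; have [] := pselect (B t); tauto.
apply: le_lt_trans (measureU2 _ _ _) _; [exact: mY..|].
by rewrite EFinD; exact: lteD.
Qed.

Lemma approximableU m A B : measurable A -> measurable B ->
  approximable m A -> approximable m B -> approximable m (A `|` B).
Proof.
move=> mA mB apA apB e e0; have e20 : 0 < e / 2 by rewrite divr_gt0.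
have [T1 [p1 [S1 [mp1 lt1]]]] := apA _ e20.
have [T2 [p2 [S2 [mp2 lt2]]]] := apB _ e20.
exists (T1 * T2)%type, (fun v => (p1 v, p2 v)),
  (fun s => S1 (map_tuple fst s) || S2 (map_tuple snd s)).
split=> [[j1 j2]|].
  rewrite (_ : _ @^-1` _ = (p1 @^-1` [set j1]) `&` (p2 @^-1` [set j2])).
    exact: measurableI.
  by apply/seteqP; split => v /= [-> ->].
have mC1 := measurable_cylinder S1 mp1; have mC2 := measurable_cylinder S2 mp2.
rewrite (_ : cylinder _ _ = cylinder p1 S1 `|` cylinder p2 S2); last first.
  apply/seteqP; split => t; rewrite /cylinder/=.
    rewrite (_ : map_tuple fst _ = map_tuple p1 t); last first.
      by apply: eq_from_tnth => i; rewrite !tnth_map.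
    rewrite (_ : map_tuple snd _ = map_tuple p2 t); last first.
      by apply: eq_from_tnth => i; rewrite !tnth_map.
    by move/orP.
  rewrite (_ : map_tuple fst _ = map_tuple p1 t); last first.
    by apply: eq_from_tnth => i; rewrite !tnth_map.
  rewrite (_ : map_tuple snd _ = map_tuple p2 t); last first.
    by apply: eq_from_tnth => i; rewrite !tnth_map.
  by move=> ?; apply/orP.
have mY (X Y : set (k.-tuple V)) :
    measurable X -> measurable Y -> measurable (X `+` Y).
  by move=> ? ?; rewrite setY_def; apply: measurableU; exact: measurableD.
apply: (@le_lt_trans _ _ (m ((A `+` cylinder p1 S1) `|` (B `+` cylinder p2 S2)))).
  apply: le_measure; rewrite ?inE//.
  - by apply: mY; exact: measurableU.
  - by apply: measurableU; exact: mY.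
  - by move=> t /=; tauto.
apply: le_lt_trans (measureU2 _ _ _) _; [exact: mY..|].
by rewrite [e]splitr EFinD; exact: lteD.
Qed.

(** Dynkin's lemma: boxes are cylinders, complements negate the predicate, and a
    countable union is cut off where its tail has small measure. *)
Lemma measurable_approximable m W : measurable W -> approximable m W.
Proof.
rewrite {1}tuple_measurableE => sW.
have approxT : approximable m setT.
  move=> e e0; exists unit, (fun=> tt), predT; split.
    by move=> j; rewrite (_ : _ @^-1` _ = setT)//; apply/seteqP; split => // v _; case: j.
  rewrite (_ : _ `+` _ = set0) ?measure0//.
  by apply/seteqP; split => // t [[_ nh]|[_ []]//]; exact: nh.
apply: (dynkin_induction tuple_measurableE) sW => //.
- move=> _ _ [B mB <-] [C mC <-]; exists (fun i => B i `&` C i).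
    by move=> i; exact: measurableI.
  by apply/seteqP; split => [t h|t [h1 h2] i]; [split => i; have [] := h i|split].
- move=> _ [B mB <-] e e0.
  exists {ffun 'I_k -> bool}, (fun v => [ffun i => v \in B i]),
    (fun s : k.-tuple {ffun 'I_k -> bool} => [forall i, tnth s i i]); split=> [j|].
    rewrite (_ : _ @^-1` _ = \bigcap_i (if j i then B i else ~` B i)).
      apply: fin_bigcap_measurable => [|i _]; first exact: finite_finset.
      by case: (j i) => //; exact: measurableC.
    apply/seteqP; split => [v /= <- i _|v /= h].
      by rewrite ffunE; case: ifPn; rewrite ?inE ?notin_setE.
    apply/ffunP => i; rewrite ffunE; have := h i I.
    by case: (j i) => [Bv|nBv]; [exact: mem_set|exact: memNset].
  rewrite (_ : cylinder _ _ = box B) ?setYK ?measure0//.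
  apply/seteqP; split => t; rewrite /cylinder/=.
    by move/forallP => h i; have := h i; rewrite tnth_map ffunE inE.
  by move=> h; apply/forallP => i; rewrite tnth_map ffunE inE; exact: h.
- move=> S mS apS e e0; have [T [p [Q [mp ltQ]]]] := apS e e0.
  exists T, p, (predC Q); split => //.
  rewrite (_ : _ `+` _ = S `+` cylinder p Q)//.
  rewrite (_ : cylinder p (predC Q) = ~` cylinder p Q).
    by rewrite /setY !setDE !setCK setUC; congr (_ `|` _); rewrite setIC.
  by apply/seteqP; split => t; rewrite /cylinder/= => /negP.
- move=> F mF tF apF e e0; have e20 : 0 < e / 2 by rewrite divr_gt0.
  have mfin n : measurable (\bigcup_(i < n) F i) by exact: bigcup_measurable.
  have apfin n : approximable m (\bigcup_(i < n) F i).
    elim: n => [|n IH].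
      rewrite (_ : \bigcup_(i < 0) F i = set0); last first.
        by apply/seteqP; split => // t [].
      move=> r r0; exists unit, (fun=> tt), pred0; split.
        by move=> j; rewrite (_ : _ @^-1` _ = setT)//; apply/seteqP; split => // v _; case: j.
      rewrite (_ : _ `+` _ = set0) ?measure0//.
      by apply/seteqP; split => // t [[]|[]]//.
    rewrite (_ : \bigcup_(i < n.+1) F i = \bigcup_(i < n) F i `|` F n).
      exact: approximableU.
    by rewrite !bigcup_mkord big_ord_recr.
  have [N tailN] : exists N, (m (\bigcup_i F i `\` \bigcup_(i < N) F i) < (e / 2)%:E)%E.
    have /fine_cvgP[_ /cvgrPdist_lt/(_ _ e20)[N _ /(_ N (leqnn N))]] :=
      measure_tail_cvg0 m mF.
    rewrite sub0r normrN /= ger0_norm ?fine_ge0// => h; exists N.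
    by rewrite -[ltLHS]fineK ?lte_fin// fin_num_measure//; apply: measurableD => //;
      exact: bigcup_measurable.
  have [T [p [Q [mp ltQ]]]] := apfin N _ e20; exists T, p, Q; split => //.
  rewrite [e]splitr; apply: symdiff_lt ltQ => //.
  - exact: bigcup_measurable.
  - exact: measurable_cylinder.
  - rewrite /setY (_ : \bigcup_(i < N) F i `\` _ = set0) ?setU0//.
    by apply/seteqP; split => // t [[i _ Fit]] []; exists i.
Qed.

End cylinders.

(** * Averaging over a finite partition *)

Section averaging.
Context d (V : measurableType d) (R : realType).
Variables (mu : {finite_measure set V -> \bar R}) (T : finType) (p : V -> T).
Hypothesis mp : forall j, measurable (p @^-1` [set j]).

Local Notation cell j := (p @^-1` [set j]).
Local Notation mass j := (fine (mu (cell j))).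

(** The conditional expectation given the partition, set to 0 on null cells. *)
Definition average (f : V -> R) : V -> R :=
  (fun j => inner mu f (\1_(cell j)) / mass j) \o p.

Lemma L2_average f : L2 mu (average f).
Proof. exact: L2_step. Qed.

Lemma average_ge0 f v : (forall x, 0 <= f x) -> 0 <= average f v.
Proof.
move=> f0; apply: divr_ge0; last exact: fine_ge0.
by apply: Rintegral_ge0 => x _; rewrite mulr_ge0.
Qed.

(** On a null cell both sides vanish, the right one by Cauchy-Schwarz. *)
Lemma inner_average_cell f j : L2 mu f ->
  inner mu (average f) (\1_(cell j)) = inner mu f (\1_(cell j)).
Proof.
move=> L2f; rewrite inner_step_cell//.
have [m0|m0] := eqVneq (mass j) 0; last by rewrite divfK.
have := cauchy_schwarz L2f (L2_cell mu mp j).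
rewrite inner_indic// setIid m0 mulr0 => h.
have /eqP := le_anti (introT andP (conj h (sqr_ge0 _))).
by rewrite sqrf_eq0 => /eqP ->; rewrite mulr0.
Qed.

Lemma inner_average_total f : L2 mu f ->
  inner mu (average f) (cst 1) = inner mu f (cst 1).
Proof.
move=> L2f; have E g : L2 mu g -> inner mu g (cst 1) = \sum_j inner mu g (\1_(cell j)).
  move=> L2g; rewrite innerC (inner_stepl mp (fun=> 1) L2g).
  by apply: eq_bigr => j _; rewrite mul1r.
rewrite !E//; last exact: L2_average.
by apply: eq_bigr => j _; rewrite inner_average_cell.
Qed.

Lemma inner_average f : inner mu (average f) (average f) =
  \sum_j inner mu f (\1_(cell j)) ^+ 2 / mass j.
Proof.
rewrite inner_step//; apply: eq_bigr => j _.
by have [->|m0] := eqVneq (mass j) 0; [rewrite invr0 !mulr0|field].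
Qed.

Lemma inner_tensor_pow_cylinder k (S : pred (k.-tuple T)) f : L2 mu f ->
  inner (mpow mu k) (tensor_pow f) (\1_(cylinder p S)) =
  \sum_(s | S s) \prod_(i < k) inner mu f (\1_(cell (tnth s i))).
Proof.
move=> L2f.
have L2c s : L2 (mpow mu k)
    (tensor (fun i => \1_(cell (tnth s i)) : V -> R)).
  by apply: L2_tensor => i; exact: L2_cell.
rewrite innerC (_ : \1_(cylinder p S) = fun t => \sum_(s | S s)
    1 * tensor (fun i => \1_(cell (tnth s i)) : V -> R) t); last first.
  by apply/funext => t; rewrite indic_cylinder; apply: eq_bigr => s _; rewrite mul1r.
under [X in inner _ X _]eq_fun do rewrite -big_filter.
rewrite inner_suml//; last exact: L2_tensor_pow.
rewrite big_filter; apply: eq_bigr => s _.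
by rewrite mul1r innerC inner_tensor_pow// => i; exact: L2_cell.
Qed.

Lemma average_cylinder k (S : pred (k.-tuple T)) f : L2 mu f ->
  inner (mpow mu k) (tensor_pow (average f)) (\1_(cylinder p S)) =
  inner (mpow mu k) (tensor_pow f) (\1_(cylinder p S)).
Proof.
move=> L2f; rewrite !inner_tensor_pow_cylinder//; last exact: L2_average.
by apply: eq_bigr => s _; apply: eq_bigr => i _; rewrite inner_average_cell.
Qed.

End averaging.

(** If X_i / Y_i > b / l held wherever Y_i > 0, summing up would give a ratio of
    the totals above b / l. *)
Lemma weighted_pigeonhole (R : realFieldType) n (c X Y : 'I_n -> R) (b l : R) :
  (forall i, 0 <= c i) -> (forall i, 0 <= X i) -> (forall i, 0 <= Y i) ->
  0 <= b -> 0 < l ->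
  \sum_i c i * X i <= b -> l <= \sum_i c i * Y i ->
  exists i, 0 < Y i /\ X i * l <= b * Y i.
Proof.
move=> c0 X0 Y0 b0 l0 Xb Yl; apply: contrapT => none.
have lt i : 0 < Y i -> b * Y i < X i * l.
  by move=> Yi; rewrite ltNge; apply/negP => le; apply: none; exists i.
have le i : c i * (b * Y i) <= c i * (X i * l).
  rewrite ler_wpM2l//; have [Yi|Yi] := ltP 0 (Y i); first exact/ltW/lt.
  by rewrite (le_anti (introT andP (conj Yi (Y0 i)))) mulr0 mulr_ge0// ltW.
have [i ci] : exists i, 0 < c i * Y i.
  apply: contrapT => nex; have := lt_le_trans l0 Yl.
  rewrite ltNge => /negP; apply; apply: sumr_le0 => i _.
  by rewrite leNgt; apply/negP => h; apply: nex; exists i.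
have ci0 : 0 < c i.
  by rewrite lt_neqAle c0 andbT eq_sym; apply: contraTneq ci => ->; rewrite mul0r ltxx.
have Yi0 : 0 < Y i by rewrite -(pmulr_rgt0 _ ci0).
have : \sum_i c i * (b * Y i) < \sum_i c i * (X i * l).
  rewrite (bigD1 i)//= [ltRHS](bigD1 i)//=; apply: ltr_leD.
    by rewrite ltr_pM2l// lt.
  by apply: ler_sum => j _.
rewrite ltNge => /negP; apply.
have -> : \sum_i c i * (X i * l) = (\sum_i c i * X i) * l.
  by rewrite mulr_suml; apply: eq_bigr => j _; rewrite mulrA.
have -> : \sum_i c i * (b * Y i) = b * (\sum_i c i * Y i).
  by rewrite mulr_sumr; apply: eq_bigr => j _; rewrite mulrCA.
apply: (@le_trans _ _ (b * l)); first by rewrite ler_wpM2r// ltW.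
exact: ler_wpM2l.
Qed.

(** * Functions of small energy and small mass on the edges *)

Section near_optimal_function.
Context d (V : measurableType d) (R : realType).
Variables (mu : {finite_measure set V -> \bar R}) (n : nat).
Local Notation muk := (mpow mu n.+2).
Local Notation one := (cst 1 : V -> R).

Lemma inner_tensor_powE f : L2 mu f ->
  inner muk (tensor_pow f) (tensor_pow f) = inner mu f f ^+ n.+2.
Proof.
move=> L2f; rewrite (@inner_tensor_pow _ _ _ mu n.+2 f (fun=> f))//.
by rewrite -[X in _ ^+ X](card_ord n.+2) -prodr_const; exact: eq_big.
Qed.

Lemma inner_tensor_pow_one f : L2 mu f ->
  inner muk (tensor_pow f) (tensor_pow one) = inner mu f one ^+ n.+2.
Proof.
move=> L2f; rewrite (@inner_tensor_pow _ _ _ mu n.+2 f (fun=> one))//.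
  by rewrite -[X in _ ^+ X](card_ord n.+2) -prodr_const; exact: eq_big.
by move=> _; exact: L2_cst.
Qed.

Variables (A : n.+2.-tuple V -> R) (E : set (n.+2.-tuple V)).
Hypotheses (CPA : CP mu n.+2 A) (mE : measurable E).
Hypothesis (vanA : vanishes_on mu E A).

(** The representative of A that vanishes on E shows that only the part of U
    outside E contributes; Cauchy-Schwarz bounds it. *)
Lemma inner_vanishing_le (U : set (n.+2.-tuple V)) (r : R) : measurable U -> 0 <= r ->
  (muk (U `\` E) <= (r ^+ 2)%:E)%E ->
  inner muk A (\1_U) <= Num.sqrt (inner muk A A) * r.
Proof.
move=> mU r0 mass; have [B [L2B BA B0]] := vanA.
have [[L2A _] _] := CPA.
have mUE : measurable (U `\` E) by exact: measurableD.
have L2UE := @L2_indic _ _ _ muk _ mUE; have L2U := @L2_indic _ _ _ muk _ mU.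
have aeE G : L2 muk G -> inner muk A G = inner muk B G.
  move=> L2G; congr fine; apply: ae_eq_integral => //.
  - apply/measurable_EFinP.
    exact: measurable_funM (L2_measurable L2A) (L2_measurable L2G).
  - apply/measurable_EFinP.
    exact: measurable_funM (L2_measurable L2B) (L2_measurable L2G).
  - by apply: filterS BA => t <-.
have -> : inner muk A (\1_U) = inner muk A (\1_(U `\` E)).
  rewrite !aeE//; apply: eq_Rintegral => t _.
  have [Et|nEt] := pselect (E t); first by rewrite B0// !mul0r.
  congr (_ * _); rewrite !indicE; congr (_ %:R).
  by rewrite in_setD [t \in E]memNset// andbT.
apply: le_trans (ler_norm _) _; apply: le_trans (norm_inner_le L2A L2UE) _.
rewrite ler_wpM2l ?sqrtr_ge0// inner_indic// setIid.
rewrite -[leRHS]ger0_norm// -sqrtr_sqr ler_wsqrtr// -lee_fin fineK//.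
exact: fin_num_measure.
Qed.

Let lam := inner muk A (tensor_pow one).
Hypothesis (lam0 : 0 < lam).
Hypothesis cells : forall (T : finType) (p : V -> T),
  (forall j, measurable (p @^-1` [set j])) ->
  \sum_j pair_form mu A (\1_(p @^-1` [set j])) (\1_(p @^-1` [set j])) /
     fine (mu (p @^-1` [set j])) <= 1.

(** The traces of the approximants of A are not bounded, but after averaging over
    the partition they are, being finite combinations of values of the form.
    Averaging does not change the mass of a union of boxes of the partition, so
    some member of the conic combination has small energy and small mass on such
    a union together; the weight M trades one against the other. *)
Lemma near_optimal_average (T : finType) (p : V -> T) (U : pred (n.+2.-tuple T))
    (M b eta : R) :
  (forall j, measurable (p @^-1` [set j])) -> 0 <= M -> 0 < eta -> eta < lam ->
  inner muk A (\1_(cylinder p U)) <= b -> 0 <= b ->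
  exists f : V -> R, [/\ L2 mu f, forall x, 0 <= f x, inner mu f one = 1 &
    inner mu f f + M * inner muk (tensor_pow f) (\1_(cylinder p U)) <=
    (1 + eta + M * (b + eta)) / (lam - eta)].
Proof.
move=> mp M0 eta0 eta_lam Ub b0.
pose cell j := p @^-1` [set j]; pose w j := (fine (mu (cell j)))^-1.
have w0 j : 0 <= w j by rewrite invr_ge0 fine_ge0.
have L2c j : L2 mu (\1_(cell j) : V -> R) by exact: L2_cell.
have L2one : L2 mu one by exact: L2_cst.
pose G j := tensor (pair_fun (\1_(cell j)) (\1_(cell j))) : n.+2.-tuple V -> R.
have L2G j : L2 muk (G j) by apply: L2_tensor => i; exact: L2_pair_fun.
have mU := measurable_cylinder U mp.
have L2U := @L2_indic _ _ R muk _ mU.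
pose N g : R := Num.sqrt (inner muk g g).
(* S bounds the norms of the two global test functions and the weighted sum of
   those on the cells, so that each of the three errors is at most eta; the final
   1 keeps S positive. *)
pose S := N (tensor_pow one) + N (\1_(cylinder p U)) + \sum_j N (G j) * w j + 1.
have N0 g : 0 <= N g by exact: sqrtr_ge0.
have sum0 : 0 <= \sum_j N (G j) * w j by apply: sumr_ge0 => j _; exact: mulr_ge0.
have S0 : 0 < S by rewrite ltr_wpDl// !addr_ge0.
have [m [c [f [cf approx]]]] := CP_approx CPA (divr_gt0 eta0 S0).
have c0 i : 0 <= c i by case: (cf i).
have L2f i : L2 mu (f i) by case: (cf i).
have f0 i x : 0 <= f i x by case: (cf i).
pose t i := inner mu (f i) one; pose a i j := inner mu (f i) (\1_(cell j)).
have t0 i : 0 <= t i by apply: Rintegral_ge0 => x _; rewrite mulr1.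
have small x : 0 <= x -> x <= S -> eta / S * x <= eta.
  move=> x0 xS; rewrite -mulrA ler_piMr//; first exact: ltW.
  by rewrite mulrC ler_pdivrMr// mul1r.
have Y1 : lam - eta <= \sum_i c i * t i ^+ n.+2.
  have := approx _ (L2_tensor_pow n.+2 L2one).
  rewrite -/lam -/(N _) ler_distl => /andP[_ h].
  have := small (N (tensor_pow one)) (N0 _).
  under eq_bigr do rewrite -inner_tensor_pow_one//.
  have : N (tensor_pow one) <= S by rewrite /S -!addrA lerDl !addr_ge0.
  by move=> /[swap] /[apply] h'; lra.
have U1 : \sum_i c i * inner muk (tensor_pow (f i)) (\1_(cylinder p U)) <= b + eta.
  have := approx _ L2U; rewrite -/(N _) ler_distl => /andP[h _].
  have := small (N (\1_(cylinder p U))) (N0 _).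
  have : N (\1_(cylinder p U)) <= S.
    by rewrite /S -!addrA [leRHS]addrCA lerDl !addr_ge0.
  by move=> /[swap] /[apply] h'; lra.
have W1 : \sum_i c i * (t i ^+ n * \sum_j a i j ^+ 2 * w j) <= 1 + eta.
  have -> : \sum_i c i * (t i ^+ n * \sum_j a i j ^+ 2 * w j) =
      \sum_j (\sum_i c i * inner muk (tensor_pow (f i)) (G j)) * w j.
    under [RHS]eq_bigr do rewrite mulr_suml.
    rewrite exchange_big/=; apply: eq_bigr => i _; rewrite !mulr_sumr.
    apply: eq_bigr => j _; rewrite inner_tensor_pow_pair// -/(a i j) -/(t i).
    by rewrite expr2; ring.
  apply: (@le_trans _ _ (\sum_j (pair_form mu A (\1_(cell j)) (\1_(cell j)) * w j +
      eta / S * (N (G j) * w j)))).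
    apply: ler_sum => j _; rewrite mulrA -mulrDl ler_wpM2r//.
    by have := approx _ (L2G j); rewrite ler_distl lerBlDr => /andP[].
  rewrite big_split/= -mulr_sumr; apply: lerD; first exact: cells.
  apply: small => //; rewrite /S -addrA addrC -addrA lerDl.
  by rewrite !addr_ge0.
have num0 : 0 <= 1 + eta + M * (b + eta).
  by rewrite !addr_ge0// ?mulr_ge0// ?addr_ge0// ltW.
have den0 : 0 < lam - eta by rewrite subr_gt0.
have mass0 i : 0 <= inner muk (tensor_pow (f i)) (\1_(cylinder p U)).
  by apply: Rintegral_ge0 => s _; rewrite mulr_ge0//; exact: prodr_ge0.
have := @weighted_pigeonhole R m c
  (fun i => t i ^+ n * (\sum_j a i j ^+ 2 * w j) +
     M * inner muk (tensor_pow (f i)) (\1_(cylinder p U)))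
  (fun i => t i ^+ n.+2) _ _ c0 _ _ num0 den0 _ Y1.
case.
- move=> i; rewrite addr_ge0// mulr_ge0// ?exprn_ge0//.
  by apply: sumr_ge0 => j _; rewrite mulr_ge0// sqr_ge0.
- by move=> i; rewrite exprn_ge0.
- under eq_bigr do rewrite mulrDr; rewrite big_split/=; apply: lerD => //.
  by under eq_bigr do rewrite mulrCA; rewrite -mulr_sumr ler_wpM2l.
move=> i [ti fi].
have {}ti : 0 < t i.
  rewrite lt_neqAle t0 andbT eq_sym; apply: contraTneq ti => ->.
  by rewrite expr0n ltxx.
pose g := average mu p (f i).
have L2g : L2 mu g by exact: L2_average.
exists (fun x => (t i)^-1 * g x); split.
- exact: L2Z.
- move=> x; rewrite mulr_ge0// ?invr_ge0//; exact: average_ge0.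
- by rewrite innerZl// inner_average_total// mulVf// gt_eqF.
have -> : inner mu (fun x => (t i)^-1 * g x) (fun x => (t i)^-1 * g x) =
    (t i)^-1 ^+ 2 * \sum_j a i j ^+ 2 * w j.
  rewrite innerZl//; last exact: L2Z.
  by rewrite [inner mu g _]innerC innerZl// inner_average// mulrA expr2.
have -> : tensor_pow (fun x => (t i)^-1 * g x) =
    (fun s : n.+2.-tuple V => (t i)^-1 ^+ n.+2 * tensor_pow g s).
  apply/funext => s; rewrite /tensor_pow big_split/=; congr (_ * _).
  by rewrite -[X in _ ^+ X](card_ord n.+2) -prodr_const; exact: eq_big.
rewrite innerZl//; last exact: L2_tensor_pow.
rewrite average_cylinder// ler_pdivlMr//.
have tn0 : 0 < t i ^+ n.+2 by rewrite exprn_gt0.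
rewrite -(ler_pM2r tn0); apply: le_trans fi.
rewrite le_eqVlt; apply/orP; left; apply/eqP.
rewrite exprVn [in LHS]mulrAC; congr (_ * _).
rewrite exprVn !exprS expr0; field.
by rewrite expf_neq0 lt0r_neq0.
Qed.

(** With U a union of boxes close to E, the average has small mass on U by the
    choice of the weight, and small mass on E outside U by Cauchy-Schwarz, since
    the energy bounds the norm of its tensor power. *)
Lemma near_optimal (e : R) : 0 < e -> exists f : V -> R,
  [/\ L2 mu f, forall x, 0 <= f x, inner mu f one = 1,
      inner mu f f <= lam^-1 + e & inner muk (tensor_pow f) (\1_E) <= e].
Proof.
(* C is the energy to be reached; the weight N makes N * mass <= C yield a mass
   at most e / 2. *)
move=> e0; pose C := lam^-1 + e; pose N := 2 * C / e.
have C0 : 0 < C by rewrite addr_gt0// invr_gt0.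
have N0 : 0 < N by rewrite divr_gt0// mulr_gt0.
pose a := Num.sqrt (inner muk A A); pose D := Num.sqrt (C ^+ n.+2).
have a0 : 0 <= a by exact: sqrtr_ge0.
have D0 : 0 <= D by exact: sqrtr_ge0.
pose r := Num.min (e / (2 * (D + 1))) (e * lam / (2 * N * (a + 1))).
have a1 : 0 < a + 1 by rewrite ltr_wpDl.
have D1 : 0 < D + 1 by rewrite ltr_wpDl.
have D2 : 0 < 2 * (D + 1) by exact: mulr_gt0.
have a2 : 0 < 2 * N * (a + 1) by apply: mulr_gt0 => //; exact: mulr_gt0.
have r0 : 0 < r.
  by rewrite /r lt_min !divr_gt0// mulr_gt0.
have Dr : D * r <= e / 2.
  apply: (@le_trans _ _ ((D + 1) * (e / (2 * (D + 1))))).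
    by apply: ler_pM; [|exact: ltW|rewrite lerDl|rewrite /r ge_min lexx].
  by rewrite le_eqVlt; apply/orP; left; apply/eqP; field; rewrite lt0r_neq0.
have ar : N * (a * r) <= e * lam / 2.
  apply: (@le_trans _ _ (N * ((a + 1) * (e * lam / (2 * N * (a + 1)))))).
    rewrite ler_pM2l//.
    by apply: ler_pM; [|exact: ltW|rewrite lerDl|rewrite /r ge_min lexx orbT].
  by rewrite le_eqVlt; apply/orP; left; apply/eqP; field; rewrite !lt0r_neq0.
(* The errors N * a * r and eta * (1 + N + C) are to fit together into the slack
   e * lam = C * lam - 1. *)
pose eta := e * lam / (2 * (1 + N + C)).
have den1 : 0 < 1 + N + C by apply: addr_gt0 => //; exact: addr_gt0.
have den0 : 0 < 2 * (1 + N + C) by exact: mulr_gt0.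
have eta0 : 0 < eta by rewrite divr_gt0// mulr_gt0.
have etaE : eta * (1 + N + C) = e * lam / 2.
  by rewrite /eta; move: den1 => /lt0r_neq0; move: (1 + N + C) => x x0; field.
have eta_lam : eta < lam.
  rewrite /eta ltr_pdivrMr// [ltRHS]mulrC ltr_pM2r//.
  have : e < C by rewrite ltrDr invr_gt0.
  by have := N0; move: (N) (C) => x y; lra.
have [T [p [U [mp apE]]]] := measurable_approximable muk mE (exprn_gt0 2 r0).
have mU := measurable_cylinder U mp.
have mUE : measurable (cylinder p U `\` E) by exact: measurableD.
have mEU : measurable (E `\` cylinder p U) by exact: measurableD.
have mY : measurable (E `+` cylinder p U) by rewrite setY_def; exact: measurableU.
have lUE : (muk (cylinder p U `\` E) <= (r ^+ 2)%:E)%E.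
  apply: le_trans (ltW apE); apply: le_measure; rewrite ?inE//.
  by move=> t h; right.
have lEU : (muk (E `\` cylinder p U) <= (r ^+ 2)%:E)%E.
  apply: le_trans (ltW apE); apply: le_measure; rewrite ?inE//.
  by move=> t h; left.
have Ub := inner_vanishing_le mU (ltW r0) lUE.
have [f [L2f f0 f1 fN]] := near_optimal_average mp (ltW N0) eta0 eta_lam Ub
  (mulr_ge0 a0 (ltW r0)).
have L2F := L2_tensor_pow n.+2 L2f.
have F0 (t : n.+2.-tuple V) : 0 <= tensor_pow f t by exact: prodr_ge0.
have massU : 0 <= inner muk (tensor_pow f) (\1_(cylinder p U)).
  by apply: Rintegral_ge0 => t _; rewrite mulr_ge0.
have {}fN : inner mu f f + N * inner muk (tensor_pow f) (\1_(cylinder p U)) <= C.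
  apply: le_trans fN _; rewrite ler_pdivrMr ?subr_gt0// mulrBr -/a.
  have -> : C * lam = 1 + e * lam by rewrite /C mulrDl mulVf// lt0r_neq0.
  by move: ar etaE; lra.
have fC : inner mu f f <= C by apply: le_trans fN; rewrite lerDl mulr_ge0// ltW.
exists f; split => //.
have L2U := @L2_indic _ _ R muk _ mU; have L2EU := @L2_indic _ _ R muk _ mEU.
have L2E := @L2_indic _ _ R muk _ mE.
apply: (@le_trans _ _ (inner muk (tensor_pow f) (\1_(cylinder p U)) +
    inner muk (tensor_pow f) (\1_(E `\` cylinder p U)))).
  rewrite -RintegralD//; [|exact: L2_integrableM..].
  apply: le_Rintegral => //; [exact: L2_integrableM| |].
    rewrite (_ : _ \o _ = (fun t => (tensor_pow f t * \1_(cylinder p U) t)%:E +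
      (tensor_pow f t * \1_(E `\` cylinder p U) t)%:E)%E) //.
    by apply: integrableD => //; exact: L2_integrableM.
  move=> t _; rewrite -mulrDr ler_wpM2l// !indicE in_setD -natrD ler_nat.
  by case: (t \in E); case: (t \in _).
rewrite [leRHS]splitr; apply: lerD.
  have : N * inner muk (tensor_pow f) (\1_(cylinder p U)) <= C.
    by apply: le_trans fN; rewrite lerDr inner_ge0.
  rewrite -ler_pdivlMl// => h; apply: le_trans h _.
  rewrite /N le_eqVlt; apply/orP; left; apply/eqP; field.
  by rewrite !lt0r_neq0.
apply: le_trans Dr; apply: le_trans (ler_norm _) _.
apply: le_trans (norm_inner_le L2F L2EU) _; apply: ler_pM; rewrite ?sqrtr_ge0//.
  rewrite inner_tensor_powE// /D ler_wsqrtr// lerXn2r// nnegrE ?inner_ge0//.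
  exact: ltW.
rewrite inner_indic// setIid -[leRHS]ger0_norm ?(ltW r0)//.
by rewrite -sqrtr_sqr ler_wsqrtr// -lee_fin fineK// fin_num_measure.
Qed.

End near_optimal_function.

(** * Weak limits of densities *)

Lemma finite_measure_add d (T : measurableType d) (R : realType)
    (m1 m2 : {finite_measure set T -> \bar R}) :
  exists m : {finite_measure set T -> \bar R}, forall A, m A = (m1 A + m2 A)%E.
Proof.
pose m : {measure set T -> \bar R} := measure_add m1 m2.
have mE A : m A = (m1 A + m2 A)%E by exact: measure_addE.
have mfin : fin_num_fun m.
  by move=> A mA; rewrite mE fin_numD !fin_num_measure.
exists (HB.pack_for (FiniteMeasure.type T R) (Measure.sort m)
  (@Measure_isFinite.Build _ _ _ m mfin)).
exact: mE.
Qed.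

(** Domination by a multiple of mu makes L continuous at the empty set, which
    upgrades finite to countable additivity. *)
Lemma measure_of_dominated_additive d (T : measurableType d) (R : realType)
    (mu : {finite_measure set T -> \bar R}) (L : set T -> R) (c : R) :
  (forall B, measurable B -> 0 <= L B) ->
  (forall A B, measurable A -> measurable B -> A `&` B = set0 ->
     L (A `|` B) = L A + L B) ->
  (forall B, measurable B -> L B ^+ 2 <= c * fine (mu B)) ->
  exists nu : {finite_measure set T -> \bar R},
    forall B, measurable B -> nu B = (L B)%:E.
Proof.
(* L is arbitrary on nonmeasurable sets, where nu must still be nonnegative. *)
move=> L0 LU Lc; pose nu B := `|L B|%:E.
have nuE B : measurable B -> nu B = (L B)%:E.
  by move=> mB; rewrite /nu ger0_norm// L0.
have Lset0 : L set0 = 0.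
  have := LU set0 set0 measurable0 measurable0 (setI0 _).
  by rewrite setU0 => /eqP; rewrite -subr_eq0 opprD addrA subrr sub0r oppr_eq0 => /eqP.
have nu_set0 : nu set0 = 0%E by rewrite nuE// Lset0.
have nu_ge0 B : (0 <= nu B)%E by rewrite lee_fin.
have nu_sigma : semi_sigma_additive nu.
  move=> F mF tF mU; pose tail n := \bigcup_k F k `\` \bigcup_(i < n) F i.
  have mtail n : measurable (tail n).
    by apply: measurableD => //; exact: bigcup_measurable.
  have split n : L (\bigcup_k F k) = \sum_(0 <= i < n) L (F i) + L (tail n).
    elim: n => [|n ->].
      rewrite big_geq// add0r; congr L; rewrite /tail (_ : \bigcup_(i < 0) F i = set0).
        by rewrite setD0.
      by apply/seteqP; split => // x [].
    rewrite big_nat_recr//= -addrA; congr (_ + _).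
    rewrite -LU//; last first.
      apply/seteqP; split => // x [Fn [_]]; apply; exists n => //=.
    congr L; apply/seteqP; split => x.
      move=> [Ux nx]; have [Fn|nFn] := pselect (F n x); [by left|right; split => //].
      move=> [i /=]; rewrite ltnS leq_eqVlt => /predU1P[->//|ltin] Fi.
      by apply: nx; exists i.
    move=> [Fn|[Ux nx]].
      split; first by exists n.
      move=> [i /= ltin Fi].
      have iE := tF i n I I (ex_intro _ x (conj Fi Fn)).
      by rewrite iE ltnn in ltin.
    by split => // -[i /= ltin Fi]; apply: nx; exists i => //=; exact: ltnW.
  rewrite nuE// (_ : (fun n => _) = fun n => (\sum_(0 <= i < n) L (F i))%:E); last first.
    by apply/funext => n; rewrite -sumEFin; apply: eq_bigr => i _; rewrite nuE.
  apply: cvg_EFin; first exact: nearW.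
  have tail0 : fine (mu (tail n)) @[n --> \oo] --> (0 : R).
    by have /fine_cvgP[] := measure_tail_cvg0 mu mF.
  have Ltail0 : L (tail n) @[n --> \oo] --> (0 : R).
    apply/cvgrPdist_le => e e0.
    have : (c * fine (mu (tail n))) @[n --> \oo] --> c * (0 : R) by exact: cvgMl_tmp.
    rewrite mulr0 => /cvgrPdist_le/(_ _ (exprn_gt0 2 e0)).
    apply: filterS => n; rewrite !sub0r !normrN => h.
    rewrite ger0_norm ?L0// -(ler_pXn2r (ltn0Sn 1)) ?nnegrE ?L0 ?(ltW e0)//.
    exact: le_trans (Lc _ (mtail n)) (le_trans (ler_norm _) h).
  have : (L (\bigcup_k F k) - L (tail n)) @[n --> \oo] --> L (\bigcup_k F k) - 0.
    by apply: cvgB => //; exact: cvg_cst.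
  rewrite subr0; apply: cvg_trans; apply: near_eq_cvg; apply: nearW => n.
  by rewrite (split n) addrK.
pose nuM : {measure set T -> \bar R} := HB.pack nu
  (isMeasure.Build _ _ _ nu nu_set0 nu_ge0 nu_sigma).
have nu_fin : fin_num_fun nuM by move=> A mA.
by exists (HB.pack_for (FiniteMeasure.type T R) (Measure.sort nuM)
  (@Measure_isFinite.Build _ _ _ nuM nu_fin)).
Qed.

(** A bounded sequence has a cluster point along any filter; along an
    ultrafilter it converges to it. *)
Lemma ultrafilter_cvg01 (R : realType) (U : set_system nat) (g : nat -> R) :
  UltraFilter U -> (forall n, 0 <= g n <= 1) -> exists l : R, g @ U --> l.
Proof.
move=> UU g01.
have [|l [_ cl]] := @segment_compact R 0 1 (g @ U) _.
  by apply: nearW => n; rewrite /= in_itv/=.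
exists l => N Nl; apply: contrapT => nUN.
have [//|UN] := in_ultra_setVsetC (g @^-1` N) UU.
by have [x []] := cl (~` N) N UN Nl.
Qed.

Section weak_limit.
Context d (V : measurableType d) (R : realType).
Variables (mu : {finite_measure set V -> \bar R}) (k : nat).
Variables (f : nat -> V -> R) (c : R) (E : set (k.-tuple V)).
Hypothesis mE : measurable E.
Hypotheses (L2f : forall i, L2 mu (f i)) (f0 : forall i x, 0 <= f i x).
Hypothesis (f1 : forall i, inner mu (f i) (cst 1) = 1).
Hypothesis (fc : forall i, inner mu (f i) (f i) <= c + i.+1%:R^-1).
Hypothesis (fE : forall i,
  inner (mpow mu k) (tensor_pow (f i)) (\1_E) <= i.+1%:R^-1).

Let inner_f_indicU i (A B : set V) : measurable A -> measurable B -> A `&` B = set0 ->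
  inner mu (f i) (\1_(A `|` B)) = inner mu (f i) (\1_A) + inner mu (f i) (\1_B).
Proof.
move=> mA mB AB0; rewrite ![inner mu (f i) _]innerC -innerDl//; try exact: L2_indic.
congr inner; apply/funext => x; rewrite !indicE in_setU -natrD.
have := in_setI x A B; rewrite AB0 in_set0.
by case: (x \in A); case: (x \in B).
Qed.

Let inner_f_indic01 i (B : set V) : measurable B -> 0 <= inner mu (f i) (\1_B) <= 1.
Proof.
move=> mB; have ge0 (C : set V) : 0 <= inner mu (f i) (\1_C).
  by apply: Rintegral_ge0 => x _; rewrite mulr_ge0.
rewrite ge0/= -(f1 i) (_ : cst 1 = \1_(B `|` ~` B) :> (V -> R)); last first.
  by rewrite setUv indicT.
rewrite inner_f_indicU//; [by rewrite lerDl|exact: measurableC|].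
by rewrite setICr.
Qed.

(** The masses of all measurable sets converge along an ultrafilter; by the energy
    bound the limit is dominated by mu, hence a measure. On a cylinder the mass
    of the tensor power is a polynomial in the masses of the cells, so it
    converges. To reach E, the cylinder is taken close to E for mu^k and nu^k
    simultaneously; the tensor powers have bounded norm and charge little the
    part of the cylinder outside E. *)
Lemma weak_limit : exists nu : {finite_measure set V -> \bar R},
  [/\ nu setT = 1%E,
      forall B, measurable B -> fine (nu B) ^+ 2 <= c * fine (mu B) &
      mpow nu k E = 0%E].
Proof.
have [U [UU subU]] := @ultraFilterLemma nat \oo _.
have cvgU (g : nat -> R) (l : R) : g @ \oo --> l -> g @ U --> l.
  by move=> gl N /gl; exact: subU.
have inv0 : (i.+1%:R^-1 : R) @[i --> U] --> (0 : R).
  by apply: cvgU; exact: cvg_harmonic.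
pose L B := lim (inner mu (f i) (\1_B) @[i --> U]).
have cvL B : measurable B -> inner mu (f i) (\1_B) @[i --> U] --> L B.
  move=> mB; have [l gl] := ultrafilter_cvg01 UU (fun i => inner_f_indic01 i mB).
  by apply/cvg_ex; exists l.
have Lc B : measurable B -> L B ^+ 2 <= c * fine (mu B).
  move=> mB; rewrite expr2.
  have cvl : inner mu (f i) (\1_B) * inner mu (f i) (\1_B) @[i --> U] --> L B * L B.
    by apply: cvgM; exact: cvL.
  have cvr : (c + i.+1%:R^-1) * fine (mu B) @[i --> U] --> (c + 0) * fine (mu B).
    by apply: cvgMr_tmp; apply: cvgD => //; exact: cvg_cst.
  rewrite -[c]addr0; apply: ler_cvg_to cvl cvr _; apply: nearW => i /=.
  rewrite -expr2; have L2B := @L2_indic _ _ _ mu _ mB.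
  apply: le_trans (cauchy_schwarz (L2f i) L2B) _.
  by rewrite inner_indic// setIid ler_wpM2r ?fine_ge0.
have [nu nuE] : exists nu : {finite_measure set V -> \bar R},
    forall B, measurable B -> nu B = (L B)%:E.
  apply: (@measure_of_dominated_additive _ _ _ mu L c).
  - move=> B mB; apply: cvgr_to_ge (cvL B mB) _; apply: nearW => i.
    by have /andP[] := inner_f_indic01 i mB.
  - move=> A B mA mB AB0; apply: (cvg_unique _ (cvL _ (measurableU _ _ mA mB))) => //.
    rewrite /=; under eq_cvg do rewrite inner_f_indicU//.
    by apply: cvgD; exact: cvL.
  - exact: Lc.
exists nu; split.
- rewrite nuE//; congr EFin.
  apply: (cvg_unique _ (cvL _ measurableT)) => //.
  apply: cvg_near_cst; apply: nearW => i.
  by rewrite -(f1 i); congr inner; rewrite indicT.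
- by move=> B mB; rewrite nuE//=; exact: Lc.
(* m measures the distance to a cylinder for both powers at once. *)
have [m mE2] := finite_measure_add (mpow mu k) (mpow nu k).
have c0 : 0 <= c + 1.
  by have := fc 0%N; rewrite invr1; exact: le_trans (inner_ge0 _ _).
pose D := Num.sqrt ((c + 1) ^+ k).
have D0 : 0 <= D by exact: sqrtr_ge0.
have D1 : 0 < D + 1 by rewrite ltr_wpDl.
suff small e : 0 < e -> fine (mpow nu k E) <= e.
  rewrite -[LHS]fineK ?fin_num_measure//; congr EFin; apply/eqP.
  rewrite eq_le fine_ge0// andbT.
  by apply/ler_addgt0Pl => e e0; rewrite addr0; exact: small.
move=> e0; pose r := Num.min 1 (e / (D + 1)).
have r0 : 0 < r by rewrite /r lt_min ltr01 divr_gt0.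
have r1 : r <= 1 by rewrite /r ge_min lexx.
have re : (D + 1) * r <= e.
  by rewrite mulrC -ler_pdivlMr// /r ge_min lexx orbT.
have [T [p [S [mp apE]]]] := measurable_approximable m mE (exprn_gt0 2 r0).
have mC := measurable_cylinder S mp; set C := cylinder p S in apE mC.
have mCE : measurable (C `\` E) by exact: measurableD.
have mEC : measurable (E `\` C) by exact: measurableD.
have mY : measurable (E `+` C) by rewrite setY_def; exact: measurableU.
have lCE : fine (mpow mu k (C `\` E)) <= r ^+ 2.
  rewrite -lee_fin fineK ?fin_num_measure//; apply: le_trans (ltW apE).
  apply: (@le_trans _ _ (m (C `\` E))); first by rewrite mE2 leeDl.
  by apply: le_measure; rewrite ?inE// => t h; right.
have lEC : fine (mpow nu k (E `\` C)) <= r ^+ 2.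
  rewrite -lee_fin fineK ?fin_num_measure//; apply: le_trans (ltW apE).
  apply: (@le_trans _ _ (m (E `\` C))); first by rewrite mE2 leeDr.
  by apply: le_measure; rewrite ?inE// => t h; left.
have nuC : fine (mpow nu k C) = \sum_(s | S s) \prod_(i < k) L (p @^-1` [set tnth s i]).
  transitivity (inner (mpow nu k) (tensor_pow (cst 1)) (\1_C)).
    rewrite (_ : tensor_pow (cst 1) = \1_setT).
      by rewrite inner_indic// setTI.
    by apply/funext => t; rewrite indicT /tensor_pow big1.
  rewrite inner_tensor_pow_cylinder//; last exact: L2_cst.
  apply: eq_bigr => s _; apply: eq_bigr => i _.
  rewrite (_ : cst 1 = \1_setT :> (V -> R)); last by rewrite indicT.
  by rewrite inner_indic// setTI nuE.
have CD : fine (mpow nu k C) <= D * r.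
  have cvC : inner (mpow mu k) (tensor_pow (f i)) (\1_C) @[i --> U] -->
      fine (mpow nu k C).
    rewrite nuC; under eq_cvg do rewrite inner_tensor_pow_cylinder//.
    apply: cvg_big => [|s _]; first exact: add_continuous.
    apply: cvg_big => [|j _]; first exact: mul_continuous.
    exact: cvL.
  have cvR : i.+1%:R^-1 + D * r @[i --> U] --> 0 + D * r.
    by apply: cvgD => //; exact: cvg_cst.
  rewrite -[leRHS]add0r; apply: ler_cvg_to cvC cvR _; apply: nearW => i /=.
  have L2F := L2_tensor_pow k (L2f i).
  have L2E := @L2_indic _ _ R (mpow mu k) _ mE.
  have L2C := @L2_indic _ _ R (mpow mu k) _ mC.
  have L2CE := @L2_indic _ _ R (mpow mu k) _ mCE.
  apply: (@le_trans _ _ (inner (mpow mu k) (tensor_pow (f i)) (\1_E) +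
     inner (mpow mu k) (tensor_pow (f i)) (\1_(C `\` E)))).
    rewrite ![inner (mpow mu k) (tensor_pow _) _]innerC -innerDl//.
    apply: le_Rintegral => //; [exact: L2_integrableM| |].
      by apply: L2_integrableM => //; exact: L2D.
    move=> t _; rewrite ler_wpM2r//; first exact: prodr_ge0.
    rewrite !indicE in_setD -natrD ler_nat.
    by case: (t \in E); case: (t \in C).
  apply: lerD => //; apply: le_trans (ler_norm _) _.
  apply: le_trans (norm_inner_le L2F L2CE) _; apply: ler_pM; rewrite ?sqrtr_ge0//.
    rewrite (@inner_tensor_pow _ _ _ mu k (f i) (fun=> f i))// /D ler_wsqrtr//.
    rewrite -[X in _ <= _ ^+ X](card_ord k) -prodr_const.
    rewrite [leRHS](eq_bigl xpredT)//.
    apply: ler_prod => j _; rewrite inner_ge0/=; apply: le_trans (fc i) _.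
    by rewrite lerD2l invf_le1 ?ltr0n// ler1n.
  rewrite inner_indic// setIid -[leRHS]ger0_norm ?(ltW r0)//.
  by rewrite -sqrtr_sqr ler_wsqrtr.
apply: (@le_trans _ _ (fine (mpow nu k C) + fine (mpow nu k (E `\` C)))).
  rewrite -fineD ?fin_num_measure// fine_le ?fin_numD ?fin_num_measure//.
  apply: (@le_trans _ _ (mpow nu k (C `|` (E `\` C)))).
    apply: le_measure; rewrite ?inE//; first exact: measurableU.
    by move=> t Et; have [Ct|nCt] := pselect (C t); [left|right].
  exact: measureU2.
apply: le_trans re; rewrite mulrDl mul1r; apply: lerD => //.
by apply: le_trans lEC _; rewrite expr2 ler_piMl// ltW.
Qed.

End weak_limit.

(** * The support of a dominated measure *)

(** S is the set where the Radon-Nikodym derivative is positive. *)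
Lemma dominated_support d (T : measurableType d) (R : realType)
    (mu nu : {finite_measure set T -> \bar R}) :
  (forall B, measurable B -> mu B = 0%E -> nu B = 0%E) ->
  exists S, [/\ measurable S, nu (~` S) = 0%E &
    forall B, measurable B -> nu B = 0%E -> mu (B `&` S) = 0%E].
Proof.
move=> dom; have /(@radon_nikodym_sigma_finite _ _ _ mu nu) : nu `<< mu.
  by apply/null_content_dominatesP.
move=> [f [f0 ffin intf fE]].
have mf : measurable_fun setT f by case/integrableP: intf.
pose S := [set x | (0 < f x)%E].
have mS : measurable S.
  by rewrite -[S]setTI; exact: emeasurable_fun_o_infty.
have mSC : measurable (~` S) by exact: measurableC.
exists S; split => //.
  rewrite fE// (eq_integral (cst 0%E)) ?integral0//.
  move=> x; rewrite inE /S/= => /negP; rewrite -leNgt => fx.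
  by apply/eqP; rewrite eq_le fx f0.
move=> B mB; rewrite fE// => intB0.
have mfB : measurable_fun B f by exact: measurable_funS mf.
have /(ae_eq_integral_abs _ mB mfB) : (\int[mu]_(x in B) `|f x| = 0)%E.
  by rewrite -[RHS]intB0; apply: eq_integral => x _; rewrite gee0_abs.
move=> [N [mN N0 sN]]; apply/eqP; rewrite -measure_le0 -N0.
apply: le_measure; rewrite ?inE//; first exact: measurableI.
move=> x [Bx Sx]; apply: sN => /= /(_ Bx) fx0.
by move: Sx; rewrite /S/= fx0 ltxx.
Qed.

Section null_powers.
Context d (V : measurableType d) (R : realType).
Variables (mu nu : {finite_measure set V -> \bar R}) (S : set V).
Hypothesis mS : measurable S.
Hypothesis nullS : forall B, measurable B -> nu B = 0%E -> mu (B `&` S) = 0%E.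

(** Fubini, by induction on n: almost every section of a null set is null. *)
Lemma mpow_null_support n (W : set (n.-tuple V)) : measurable W ->
  mpow nu n W = 0%E ->
  mpow mu n (W `&` [set t | forall i, S (tnth t i)]) = 0%E.
Proof.
elim: n W => [|n IH] W mW W0.
  apply/eqP; rewrite -measure_le0 -[leRHS]W0.
  apply: (@le_trans _ _ (mpow nu 0 (W `&` [set t | forall i, S (tnth t i)]))) => //.
  apply: le_measure; rewrite ?inE//.
  by apply: measurableI => //; exact: (@measurable_box _ _ _ (fun=> S)).
set SS := [set t : n.+1.-tuple V | forall i, S (tnth t i)].
have mSS : measurable SS by exact: (@measurable_box _ _ _ (fun=> S)).
have mW' : measurable (@tcons _ V n @^-1` W).
  by rewrite -[X in measurable X]setTI; exact: measurable_tcons.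
have mWS : measurable (@tcons _ V n @^-1` (W `&` SS)).
  rewrite -[X in measurable X]setTI; apply: measurable_tcons => //.
  exact: measurableI.
have intW : (\int[nu]_x mpow nu n (xsection (@tcons _ V n @^-1` W) x) = 0)%E by exact: W0.
pose g x := mpow nu n (xsection (@tcons _ V n @^-1` W) x).
have mg : measurable_fun setT g by exact: measurable_fun_xsection.
have /(ae_eq_integral_abs _ measurableT mg) : (\int[nu]_x `|g x| = 0)%E.
  by rewrite -[RHS]intW; apply: eq_integral => x _; rewrite gee0_abs// measure_ge0.
move=> [N [mN N0 sN]].
have muNS := nullS mN N0.
transitivity (\int[mu]_x mpow mu n (xsection (@tcons _ V n @^-1` (W `&` SS)) x))%E => //.
pose h x := mpow mu n (xsection (@tcons _ V n @^-1` (W `&` SS)) x).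
have mh : measurable_fun setT h by exact: measurable_fun_xsection.
transitivity (\int[mu]_x `|h x|)%E.
  by apply: eq_integral => x _; rewrite gee0_abs// measure_ge0.
apply/(ae_eq_integral_abs _ measurableT mh).
exists (N `&` S); split; [exact: measurableI|exact: muNS|].
move=> x /= nhx; apply: contrapT => nNS; apply: nhx => _.
rewrite /h; have [Sx|nSx] := pselect (S x); last first.
  rewrite (_ : xsection _ x = set0) ?measure0//.
  apply/seteqP; split => // t /=; rewrite /xsection/= inE => -[_ /(_ ord0)].
  by rewrite tnth0.
have gx : g x = 0%E.
  by apply: contrapT => gx; apply: nNS; split => //; apply: sN => /(_ I).
have mWx : measurable (xsection (@tcons _ V n @^-1` W) x) by exact: measurable_xsection.
have := IH _ mWx gx => IHx; apply/eqP; rewrite -measure_le0 -[leRHS]IHx.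
apply: le_measure; rewrite ?inE//.
- exact: measurable_xsection.
- by apply: measurableI => //; exact: (@measurable_box _ _ _ (fun=> S)).
- move=> t /=; rewrite /xsection/= !inE => -[Wt SSt]; split => // i.
  by have := SSt (lift ord0 i); rewrite tnthS.
Qed.

End null_powers.

(** * Thick edge sets *)

(** The Weierstrass product inequality. *)
Lemma prodr_ge_1subr_sum (R : realDomainType) n (x : 'I_n -> R) :
  (forall i, 0 <= x i <= 1) -> 1 - \sum_i (1 - x i) <= \prod_i x i.
Proof.
elim: n x => [|n IH] x x01; first by rewrite !big_ord0 subr0.
rewrite !big_ord_recl; set s := \sum_(i < n) _; set q := \prod_(i < n) _.
have sq : 1 - s <= q by apply: IH => i; exact: x01.
have q1 : q <= 1 by apply: prodr_ile1 => i _; exact: x01.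
have /andP[x0 x1] := x01 ord0; nra.
Qed.

Section thick_independence.
Context d (V : measurableType d) (R : realType).
Variables (mu : {finite_measure set V -> \bar R}) (k : nat).
Variable H : measurable_hypergraph V k.
Local Notation E := (tuples_of H).

Lemma edge_enumeration e : edges H e ->
  exists2 t : k.-tuple V, E t & forall i, e (tnth t i).
Proof.
move=> He; have /card_esym/card_set_bijP[g [gfun _ gsurj]] := edges_card He.
exists [tuple g i | i < k]; last first.
  by move=> i; rewrite tnth_mktuple; apply: gfun => /=.
rewrite /tuples_of /edge_tuples/= (_ : [set x | _] = e)//.
apply/seteqP; split => x /=.
  by move=> /mapP[i _ ->]; apply: gfun => /=.
move=> /gsurj[i /= ik <-]; apply/mapP; exists (Ordinal ik) => //.
by rewrite mem_enum.
Qed.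

(** Near t choose a box in whose sides S has proportion above 1 - delta. Then S^k
    misses at most a proportion k delta of the box, while E, which is almost
    disjoint from S^k, has a proportion above l / 2 in it. *)
Lemma density_points_edge_free (D : set (set V)) (S : set V) (t : k.-tuple V) :
  measurable S -> mpow mu k (E `&` [set t | forall i, S (tnth t i)]) = 0%E ->
  density_system mu D -> thick_wrt mu D E -> E t ->
  ~ forall i, density_points mu D S (tnth t i).
Proof.
move=> mS null [Dpos Ddir _] thickE Et densS.
have mE : measurable E by exact: edges_measurable.
have [l [l0 cvl]] := thickE t Et.
(* k + 1 instead of k makes the bound k * delta < l / 2 strict. *)
pose delta := l / (2 * k.+1%:R).
have k0 : 0 < 2 * k.+1%:R :> R by rewrite mulr_gt0.
have delta0 : 0 < delta by exact: divr_gt0.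
have kd : k%:R * delta < l / 2.
  have -> : l / 2 = k.+1%:R * delta.
    rewrite /delta; have : k.+1%:R != 0 :> R by rewrite pnatr_eq0.
    by move: (k.+1%:R) => K K0; field.
  by rewrite ltr_pM2r// ltr_nat.
have [B0 B0t B0P] := cvl (ball l (l / 2)) (nbhsx_ballx _ _ (divr_gt0 l0 (ltr0Sn _ 1))).
have dens i : exists B, [/\ D B, B (tnth t i), B `<=` B0 i &
    1 - delta < fine (mu (B `&` S)) / fine (mu B)].
  have [C [DC Ct] CP] := densS i (ball (1 : R) delta) (nbhsx_ballx (1 : R) _ delta0).
  have [DB0 B0ti] := B0t i.
  have [B [DB Bt BB0 BC]] := Ddir _ _ _ DB0 B0ti DC Ct.
  exists B; split => //.
  have /= := CP B (And3 DB Bt BC).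
  by rewrite /ball/= ltr_norml => /andP[_]; rewrite ltrBlDr ltrBlDl addrC.
have [B BP] := choice dens.
have mB i : measurable (B i) by have [/Dpos[]] := BP i.
have Bpos i : 0 < fine (mu (B i)).
  have [/Dpos[_ pos] _ _ _] := BP i.
  by rewrite fine_gt0// pos ltey_eq fin_num_measure.
have mBS i : measurable (B i `&` S) by exact: measurableI.
have prodpos : 0 < \prod_(i < k) fine (mu (B i)) by apply: prodr_gt0.
have inB0 i : [/\ D (B i), B i (tnth t i) & B i `<=` B0 i] by have [] := BP i.
have := B0P B inB0; rewrite /ball/= ltr_norml => /andP[_].
rewrite ltrBlDr -ltrBlDl (_ : l - l / 2 = l / 2); last by field.
rewrite ltNge => /negP; apply; rewrite ler_pdivrMr//.
set q := \prod_(i < k) fine (mu (B i)).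
pose box C := [set s : k.-tuple V | forall i : 'I_k, C i (tnth s i)].
pose BS i := B i `&` S.
have mbox C : (forall i, measurable (C i)) -> measurable (box C).
  exact: measurable_box.
have boxE C : (forall i, measurable (C i)) ->
    fine (mpow mu k (box C)) = \prod_(i < k) fine (mu (C i)).
  move=> mC; rewrite mpow_box// (_ : (\prod_(i < k) mu (C i))%E =
    (\prod_(i < k) fine (mu (C i)))%:E)//.
  by rewrite -prodEFin; apply: eq_bigr => i _; rewrite fineK// fin_num_measure.
have mB' := mbox _ mB; have mBS' := mbox _ mBS.
have mbE : measurable (box B `&` E) by exact: measurableI.
have mSk : measurable [set t : k.-tuple V | forall i, S (tnth t i)].
  exact: (@measurable_box _ _ _ (fun=> S)).
have mES := measurableI _ _ mE mSk.
have leq1 : fine (mpow mu k (box B `&` E)) <= q - \prod_(i < k) fine (mu (BS i)).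
  rewrite lerBrDr /q -!boxE// -fineD ?fin_num_measure//.
  rewrite fine_le ?fin_numD ?fin_num_measure//.
  rewrite -[leRHS]adde0 -null [leRHS](_ : _ = (mpow mu k (box B) +
    mpow mu k (E `&` [set t | forall i, S (tnth t i)]))%E)//.
  have subBS : box BS `<=` box B by move=> s h i; have [] := h i.
  rewrite (measureDI (mpow mu k) mB' mBS') (setIidr subBS) addeAC leeD2r//.
  apply: (@le_trans _ _ (mpow mu k ((box B `\` box BS) `|`
      (E `&` [set t | forall i, S (tnth t i)])))).
    apply: le_measure; rewrite ?inE//.
      by apply: measurableU => //; exact: measurableD.
    move=> s [Bs Es]; have [Ss|nSs] := pselect (forall i, S (tnth s i)).
      by right.
    by left; split => // h; apply: nSs => i; have [] := h i.
  by apply: measureU2 => //; exact: measurableD.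
apply: le_trans leq1 _.
pose x i := fine (mu (BS i)) / fine (mu (B i)).
have x01 i : 0 <= x i <= 1.
  rewrite divr_ge0 ?fine_ge0//= ler_pdivrMr// mul1r fine_le//.
  - by rewrite fin_num_measure//; exact: mBS.
  - by rewrite fin_num_measure.
  by apply: le_measure; rewrite ?inE//; [exact: mBS|exact: subIsetl].
have -> : \prod_(i < k) fine (mu (BS i)) = q * \prod_(i < k) x i.
  rewrite -big_split/=; apply: eq_bigr => i _.
  by rewrite /x mulrC divfK// gt_eqF.
have := prodr_ge_1subr_sum x01.
have : \sum_i (1 - x i) <= k%:R * delta.
  rewrite mulr_natl -[X in _ *+ X](card_ord k) -sumr_const.
  apply: ler_sum => i _; have [_ _ _] := BP i.
  by rewrite -/(BS i) -/(x i) => /ltW; rewrite lerBlDr lerBlDl addrC.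
move: prodpos kd; rewrite -/q; move: (\sum_i _) (\prod_i _) => s p; nra.
Qed.

(** The exceptional points of S lie in a measurable null set N, and every point
    of S outside N is a density point of S. *)
Lemma null_power_le_alpha (S : set V) : measurable S -> (0 < mu S)%E ->
  mpow mu k (E `&` [set t | forall i, S (tnth t i)]) = 0%E ->
  thick mu E -> (mu S <= alpha mu H)%E.
Proof.
move=> mS S0 null [D [dsD thickE]]; have [_ _ dens] := dsD.
have [N [mN N0 sN]] := dens S mS S0.
have mSN : measurable (S `\` N) by exact: measurableD.
apply: (@le_trans _ _ (mu (S `\` N))).
  rewrite (measureDI mu mS mN) [X in (_ + X)%E](_ : _ = 0%E) ?adde0//.
  apply/eqP; rewrite -measure_le0 -N0; apply: le_measure; rewrite ?inE//.
  exact: measurableI.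
apply: ereal_sup_ubound; exists (S `\` N) => //; split => // e He sub.
have [t Et te] := edge_enumeration He.
apply: (density_points_edge_free mS null dsD thickE Et) => i.
have [Si nN] := sub _ (te i); apply: contrapT => nd; apply: nN; apply: sN.
by left.
Qed.

End thick_independence.

(** * The upper bound *)

Section theta_le_alpha.
Context d (V : measurableType d) (R : realType).
Variables (mu : {finite_measure set V -> \bar R}) (n : nat).
Variable H : measurable_hypergraph V n.+2.

(** The support S of the weak limit nu satisfies
    1 = nu(S)^2 <= mu(S) / lam. *)
Lemma feasible_le_alpha (A : n.+2.-tuple V -> R) :
  (0 <= alpha mu H)%E -> thick mu (tuples_of H) -> CP mu n.+2 A ->
  trace_class_with_trace mu (Tstar mu A) 1 -> vanishes_on mu (tuples_of H) A ->
  ((inner (mpow mu n.+2) A (tensor_pow (cst 1)))%:E <= alpha mu H)%E.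
Proof.
move=> alpha0 thickE CPA [L2K [s [u [v [svd _ tr]]]]] vanA.
set lam := inner _ _ _; have [lam0|lam0] := ltP 0 lam; last first.
  by apply: le_trans alpha0; rewrite lee_fin.
have [[L2A _] _] := CPA.
have mE : measurable (tuples_of H) by exact: edges_measurable.
have formE g h : L2 mu g -> L2 mu h ->
    inner (mu \x mu)%E (Tstar mu A) (fun p => g p.1 * h p.2) = pair_form mu A g h.
  by move=> L2g L2h; exact: inner_Tstar.
have cells (T : finType) (p : V -> T) :
  (forall j, measurable (p @^-1` [set j])) ->
  \sum_j pair_form mu A (\1_(p @^-1` [set j])) (\1_(p @^-1` [set j])) /
     fine (mu (p @^-1` [set j])) <= 1.
  move=> mp; have := trace_cells L2K svd _ _ mp tr.
  have -> : \sum_j pair_form mu A (\1_(p @^-1` [set j])) (\1_(p @^-1` [set j])) /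
      fine (mu (p @^-1` [set j])) =
    \sum_j inner (mu \x mu)%E (Tstar mu A) (fun q =>
      (\1_(p @^-1` [set j]) : V -> R) q.1 * (\1_(p @^-1` [set j]) : V -> R) q.2) /
      fine (mu (p @^-1` [set j])).
    by apply: eq_bigr => j _; rewrite formE//; exact: (L2_indic mu (mp j)).
  apply.
  - by move=> g h L2g L2h; rewrite !formE// pair_formC.
  - by move=> g L2g; rewrite formE//; exact: pair_form_ge0.
have /choice[f fP] : forall i : nat, exists f : V -> R,
  [/\ L2 mu f, forall x, 0 <= f x, inner mu f (cst 1) = 1,
      inner mu f f <= lam^-1 + i.+1%:R^-1 &
      inner (mpow mu n.+2) (tensor_pow f) (\1_(tuples_of H)) <= i.+1%:R^-1].
  by move=> i; apply: near_optimal => //; rewrite invr_gt0 ltr0n.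
have [nu [nu1 nuc nuE]] : exists nu : {finite_measure set V -> \bar R},
  [/\ nu setT = 1%E,
      forall B, measurable B -> fine (nu B) ^+ 2 <= lam^-1 * fine (mu B) &
      mpow nu n.+2 (tuples_of H) = 0%E].
  by apply: (@weak_limit _ _ _ mu n.+2 f) => // i; have [] := fP i.
have dom B : measurable B -> mu B = 0%E -> nu B = 0%E.
  move=> mB B0; have := nuc B mB; rewrite B0 mulr0 => h.
  have /eqP := le_anti (introT andP (conj h (sqr_ge0 _))).
  by rewrite sqrf_eq0 => /eqP fB; rewrite -[LHS]fineK ?fin_num_measure// fB.
have [S [mS nuS nullS]] := dominated_support dom.
have nuS1 : nu S = 1%E.
  rewrite -nu1 -(setUv S) measureU ?setICr//; last exact: measurableC.
  by rewrite [X in (_ + X)%E](_ : _ = 0%E) ?adde0.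
have lamS : lam <= fine (mu S).
  have := nuc S mS; rewrite nuS1/= expr1n.
  by rewrite ler_pdivlMl// mulr1.
apply: (@le_trans _ _ (mu S)).
  by rewrite -[leRHS]fineK ?fin_num_measure// lee_fin.
apply: null_power_le_alpha => //.
  by rewrite -[ltRHS]fineK ?fin_num_measure// lte_fin (lt_le_trans lam0).
exact: (mpow_null_support mS nullS mE nuE).
Qed.

End theta_le_alpha.

(** * The lower bound *)

Section alpha_le_theta.
Context d (V : measurableType d) (R : realType).
Variables (mu : {finite_measure set V -> \bar R}) (n : nat).
Local Notation muk := (mpow mu n.+2).
Variable I : set V.
Hypotheses (mI : measurable I) (I0 : (0 < mu I)%E).

Let m : R := fine (mu I).

Let m0 : 0 < m.
Proof. by rewrite /m fine_gt0// I0 ltey_eq fin_num_measure. Qed.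

Let L2I : L2 mu (\1_I : V -> R). Proof. exact: L2_indic. Qed.

(** Integrating out n coordinates leaves m^-1 times the rank-one kernel of \1_I,
    whose trace is m. *)
Definition indicator_kernel (t : n.+2.-tuple V) : R :=
  m^-1 ^+ n.+1 * tensor_pow (\1_I) t.

Let L2F : L2 muk (tensor_pow (\1_I)). Proof. exact: L2_tensor_pow. Qed.

Let integral_indic : inner mu (\1_I) (cst 1) = m.
Proof.
rewrite (_ : cst 1 = \1_setT :> (V -> R)); last by rewrite indicT.
by rewrite inner_indic// setIT.
Qed.

Lemma indicator_kernel_cons2 x y (v : n.-tuple V) :
  indicator_kernel (@cons2 _ V n.+2 x y v) =
  m^-1 ^+ n.+1 * (\1_I x * (\1_I y * tensor_pow (\1_I) v)).
Proof.
rewrite /indicator_kernel -tcons_cons2.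
by rewrite [tensor_pow _ _](tensor_tcons (fun=> \1_I)) tensor_tcons.
Qed.

Lemma indicator_kernel_mass : inner muk indicator_kernel (tensor_pow (cst 1)) = m.
Proof.
rewrite innerZl//; last by apply: L2_tensor_pow; exact: L2_cst.
rewrite inner_tensor_pow_one// integral_indic [m ^+ _]exprSr mulrA -exprMn.
by rewrite mulVf ?gt_eqF// expr1n mul1r.
Qed.

Lemma indicator_kernel_CP : CP mu n.+2 indicator_kernel.
Proof.
split; first split.
- exact: L2Z.
- move=> s; apply: aeW => t; congr (_ * _); rewrite /tensor_pow.
  rewrite [RHS](reindex_inj (@perm.perm_inj _ s))/=.
  by apply: eq_bigr => i _; rewrite tnth_mktuple.
move=> e e0; exists 1%N, (fun=> m^-1 ^+ n.+1), (fun=> \1_I); split.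
  by move=> _; split => //; rewrite exprn_ge0// invr_ge0 ltW.
rewrite (_ : (fun t => _) = fun=> 0); last first.
  by apply/funext => t; rewrite big_ord1 subrr.
by rewrite norm2_0 lte_fin.
Qed.

Lemma indicator_kernel_slice_positive : slice_positive mu indicator_kernel.
Proof.
move=> G f L2G G0 L2f; pose J := inner mu (\1_I) f.
apply: Rintegral_ge0 => v _.
have ifI := L2_integrableM L2I L2f.
have -> : \int[mu]_x \int[mu]_y (indicator_kernel (cons2 x y v) * G v * f x * f y) =
    \int[mu]_x ((m^-1 ^+ n.+1 * tensor_pow (\1_I) (v : n.-tuple V) * G v * J) *
      (\1_I x * f x)).
  apply: eq_Rintegral => x _.
  under eq_Rintegral => y _.
    rewrite indicator_kernel_cons2.
    rewrite (_ : _ * f y = (m^-1 ^+ n.+1 * tensor_pow (\1_I) (v : n.-tuple V) * G v *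
      (\1_I x * f x)) * (\1_I y * f y)); last by rewrite /=; ring.
    over.
  by rewrite RintegralZl// -/(inner mu (\1_I) f) -/J mulrAC.
rewrite RintegralZl// -/(inner mu (\1_I) f) -/J -[_ * J * J]mulrA.
apply: mulr_ge0; last by rewrite -expr2 sqr_ge0.
rewrite mulr_ge0// mulr_ge0//.
  by rewrite exprn_ge0// invr_ge0 ltW.
exact: prodr_ge0.
Qed.

Lemma Tstar_indicator_kernel p :
  Tstar mu indicator_kernel p = m^-1 * (\1_I p.1 * \1_I p.2).
Proof.
rewrite /Tstar/=; under eq_Rintegral => v _.
  rewrite indicator_kernel_cons2.
  rewrite (_ : _ * _ = (m^-1 ^+ n.+1 * (\1_I p.1 * \1_I p.2)) *
    tensor (fun=> \1_I) (v : n.-tuple V)); last by rewrite /tensor_pow /tensor; ring.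
  over.
have iI := L2_integrable L2I.
have [int val] := @tensor_integral _ _ _ mu n (fun=> \1_I) (fun=> iI).
rewrite RintegralZl// val.
have -> : \prod_(i < n) \int[mu]_x \1_I x = m ^+ n.
  rewrite -[X in _ ^+ X](card_ord n) -prodr_const; apply: eq_big => // i _.
  by rewrite -integral_indic; apply: eq_Rintegral => x _; rewrite mulr1.
rewrite mulrAC exprSr -[_ * _ * m ^+ n]mulrAC -exprMn mulVf ?gt_eqF//.
by rewrite expr1n mul1r.
Qed.

(** A single singular value 1, with both vectors equal to the normalised
    indicator of I. *)
Lemma indicator_kernel_trace :
  trace_class_with_trace mu (Tstar mu indicator_kernel) 1.
Proof.
pose w : V -> R := fun x => (Num.sqrt m)^-1 * \1_I x.
have sm0 : Num.sqrt m != 0 by rewrite gt_eqF// sqrtr_gt0.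
have L2w : L2 mu w by exact: L2Z.
have ww : inner mu w w = 1.
  rewrite innerZl// innerC innerZl// inner_indic// setIid -/m mulrA -invfM.
  by rewrite -expr2 sqr_sqrtr ?(ltW m0)// mulVf// gt_eqF.
have TE : Tstar mu indicator_kernel = fun p => w p.1 * w p.2.
  apply/funext => p; rewrite Tstar_indicator_kernel /w mulrACA -invfM -expr2.
  by rewrite sqr_sqrtr// ltW.
split; first by rewrite TE; exact: L2_prodM.
pose s (i : nat) : R := (i == 0%N)%:R.
have sum_s (F : nat -> R) N : \sum_(i < N.+1) s i * F i = F 0%N.
  by rewrite big_ord_recl/= /s mul1r big1 ?addr0// => i _; rewrite mul0r.
have ser1 : series (fun i => s i * 1) @ \oo --> (1 : R).
  apply: cvg_near_cst; exists 1%N => // -[//|N] _.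
  by rewrite /series/= big_mkord (sum_s (fun=> 1)).
exists s, (fun=> w), (fun=> w); split.
- split => //.
  + by move=> i j; rewrite /s !pnatr_eq0 !eqb0 !negbK => /eqP -> /eqP ->; rewrite ww.
  + apply: cvg_near_cst; exists 1%N => // -[//|N] _.
    rewrite (_ : (fun p => _) = fun=> 0); last first.
      apply/funext => p; rewrite TE.
      under eq_bigr do rewrite -mulrA.
      by rewrite (sum_s (fun=> w p.1 * w p.2)) subrr.
    exact: norm2_0.
- apply/cvg_ex; exists 1; rewrite (_ : s = fun i => s i * 1)//.
  by apply/funext => i; rewrite mulr1.
- by rewrite ww.
Qed.

Variable H : measurable_hypergraph V n.+2.
Hypothesis indI : independent H I.

Lemma indicator_kernel_vanishes : vanishes_on mu (tuples_of H) indicator_kernel.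
Proof.
exists indicator_kernel; split; [exact: L2Z|exact: aeW|move=> t Et].
have [i nIi] : exists i, ~ I (tnth t i).
  apply: contrapT => /forallNP all; apply: (indI Et) => x /= /tnthP[i ->].
  exact: contrapT (all i).
by rewrite /indicator_kernel /tensor_pow (bigD1 i)//= indicE memNset// mul0r mulr0.
Qed.

Lemma independent_le_theta : (mu I <= theta_big mu H (CP mu n.+2))%E.
Proof.
apply: ereal_sup_ubound; exists indicator_kernel; last first.
  by rewrite indicator_kernel_mass /m fineK// fin_num_measure.
split.
- exact: indicator_kernel_CP.
- exact: indicator_kernel_slice_positive.
- exact: indicator_kernel_trace.
- exact: indicator_kernel_vanishes.
Qed.

End alpha_le_theta.

Theorem theorem4p9 (R : realType) (d : measure_display) (V : measurableType d)
    (mu : {finite_measure set V -> \bar R}) (k : nat)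
    (H : measurable_hypergraph V k) :
  (2 <= k)%N ->
  countably_generated V ->
  (0 < alpha mu H)%E ->
  thick mu (tuples_of H) ->
  alpha mu H = theta_big mu H (CP mu k).
Proof.
case: k H => [|[|n]]// H _ _ alpha0 thickE; apply/eqP; rewrite eq_le; apply/andP; split.
  (* Null independent sets do not yield a kernel; they are covered by 0 <= theta,
     which holds as some independent set is not null. *)
  have [_ [I [mI indI] <-] I0] := ereal_sup_gt alpha0.
  have theta0 := le_trans (ltW I0) (independent_le_theta mI I0 indI).
  apply: ge_ereal_sup => _ [J [mJ indJ] <-].
  have [J0|J0] := ltP 0%E (mu J); first exact: independent_le_theta.
  exact: le_trans theta0.
apply: ge_ereal_sup => _ [A [CPA _ trA vanA] <-].
exact: feasible_le_alpha (ltW alpha0) thickE CPA trA vanA.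
Qed.
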